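(* Let $a_1,\dots,a_n$ be distinct complex numbers and $a=(a_1,\dots,a_n)$. Define $$\mathfrak{C}_1=\{(xa_1+y,xa_2+y,\dots,xa_n+y)\mid x\in\mathbb{C}^*,\,y\in\mathbb{C}\},$$ $$\mathfrak{C}_2=\{(x(a_1-a_i)^{-1}+y,\dots,x(a_n-a_i)^{-1}+y)\mid x\in\mathbb{C}^*,\,y\in\mathbb{C},\,1\le i\le n\},$$ where one sets $0^{-1}=0$. Then: (a) $\mathfrak{C}_1$ is the set of all $a'\in\mathbb{C}^m$, for some $m\in\mathbb{N}$, such that $\mathscr{V}_{a'}\simeq\mathscr{V}_a$ under isomorphisms of the first kind; (b) $\mathfrak{C}_2$ is the set of all $a'\in\mathbb{C}^m$, for some $m\in\mathbb{N}$, such that $\mathscr{V}_{a'}\simeq\mathscr{V}_a$ under isomorphisms of the second kind; (c) $\mathfrak{C}_1\cup\mathfrak{C}_2$ is the set of all $a'\in\mathbb{C}^m$, for some $m\in\mathbb{N}$, such that $\mathscr{V}_{a'}\simeq\mathscr{V}_a$.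
   Context: $\mathbb{N}=\{1,2,\dots\}$, $\mathbb{C}^*=\mathbb{C}\setminus\{0\}$. For a tuple $a=(a_1,\dots,a_n)$ of distinct complex numbers, $R_a$ is the subalgebra of $\mathbb{C}(t)$ generated by $t,(t-a_1)^{-1},\dots,(t-a_n)^{-1}$, and $\mathscr{V}_a=\operatorname{Der}(R_a)=R_a\partial$ with $\partial=d/dt$, a Lie algebra with bracket $[f\partial,g\partial]=(f\partial(g)-g\partial(f))\partial$; the tuples $a'$ are likewise tuples of distinct complex numbers, and $\simeq$ means isomorphic as Lie algebras. A Lie algebra isomorphism $\psi:\mathscr{V}_a\to\mathscr{V}_{a'}$, where $a,a'$ both have $n$ coordinates, is of the first kind if, after reordering the $a'_i$ if necessary, there is $c\in\mathbb{C}^*$ with $a_i-a_1=c(a'_i-a'_1)$ and $\psi((t-a_i)^k\partial)=c^{k-1}(t-a'_i)^k\partial$ for all $k\in\mathbb{Z}$, $1\le i\le n$. It is of the second kind if, after reordering the $a_i$ and $a'_i$ if necessary, there is $c\in\mathbb{C}^*$ with $(a_i-a_1)(a'_i-a'_1)=c$ for all $i\ne1$, and $\psi((t-a_1)^k\partial)=-c^{k-1}(t-a'_1)^{2-k}\partial$, $\psi((t-a_i)^k\partial)=-c^{-1}(a_1-a_i)^k(t-a'_i)^k(t-a'_1)^{2-k}\partial$ for $i>1$, for all $k\in\mathbb{Z}$.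
   Formalization: The three set equalities are stated up to reordering of coordinates: C_1, C_2 and their union are replaced by their closures under permutation, since for ordered tuples (a) fails, e.g. a=(0,1,3), a'=(1,0,3), where V_a'=V_a but a' is not in C_1. *)

(* Defs.v *)
From HB Require Import structures.
From mathcomp Require Import all_boot all_order all_algebra.
From mathcomp Require Import generic_quotient fraction ring.
From mathcomp Require Import mathcomp_extra boolp classical_sets functions.

Set Implicit Arguments.
Unset Strict Implicit.
Unset Printing Implicit Defensive.

Import Order.TTheory GRing.Theory Num.Theory.
Local Open Scope ring_scope.

Definition ratfun (K : fieldType) := {fraction {poly K}}.

HB.instance Definition _ (K : fieldType) := GRing.Field.copy (ratfun K) {fraction {poly K}}.

(* The usual d/dt; the quotient rule is applied to a representative p / q. *)
HB.lock Definition ratfun_deriv (K : fieldType) (f : ratfun K) : ratfun K :=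
  let p := \n_(repr f) in let q := \d_(repr f) in
  FracField.tofrac (p^`() * q - p * q^`()) / FracField.tofrac (q ^+ 2).
Arguments ratfun_deriv {K} f.
Canonical ratfun_deriv_unlockable := Unlockable ratfun_deriv.unlock.

Section RatFun.
Variable K : fieldType.
Local Notation "p %:F" := (@FracField.tofrac {poly K} p : ratfun K).

Definition ratfun_scale (c : K) (f : ratfun K) : ratfun K := c%:P%:F * f.

Lemma ratfun_scaleA c d f :
  ratfun_scale c (ratfun_scale d f) = ratfun_scale (c * d) f.
Proof. by rewrite /ratfun_scale polyCM tofracM mulrA. Qed.

Lemma ratfun_scale1 : left_id 1 ratfun_scale.
Proof. by move=> f; rewrite /ratfun_scale polyC1 tofrac1 mul1r. Qed.

Lemma ratfun_scaleDr : right_distributive ratfun_scale +%R.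
Proof. by move=> c f g; rewrite /ratfun_scale mulrDr. Qed.

Lemma ratfun_scaleDl f : {morph ratfun_scale^~ f : c d / c + d}.
Proof. by move=> c d; rewrite /ratfun_scale polyCD tofracD mulrDl. Qed.

HB.instance Definition _ := GRing.Zmodule_isLmodule.Build K (ratfun K)
  ratfun_scaleA ratfun_scale1 ratfun_scaleDr ratfun_scaleDl.

Lemma ratfun_scaleAl (c : K) (f g : ratfun K) : c *: (f * g) = (c *: f) * g.
Proof. exact: mulrA. Qed.

HB.instance Definition _ := GRing.Lmodule_isLalgebra.Build K (ratfun K)
  ratfun_scaleAl.

Lemma ratfun_scaleAr (c : K) (f g : ratfun K) : c *: (f * g) = f * (c *: g).
Proof. exact: mulrCA. Qed.

HB.instance Definition _ := GRing.Lalgebra_isAlgebra.Build K (ratfun K)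
  ratfun_scaleAr.

Definition ratfun_t : ratfun K := 'X%:F.

Lemma ratfun_repr (f : ratfun K) :
  f = (\n_(repr f))%:F / (\d_(repr f))%:F.
Proof.
have d0 : (\d_(repr f))%:F != 0. by rewrite tofrac_eq0; exact: denom_ratioP.
apply: (canRL (mulfK d0)) => {d0}.
rewrite -{1}[f]reprK; move: (repr f) => r.
unlock FracField.tofrac; rewrite -[LHS]FracField.pi_mul /FracField.mulf.
apply/eqmodP; rewrite /= FracField.equivfE !numden_Ratio ?oner_eq0 ?mulr1 //.
  by rewrite mulrC.
all: exact: denom_ratioP.
Qed.

Lemma ratfun_derivE (p q : {poly K}) : q != 0 ->
  ratfun_deriv (p%:F / q%:F) = (p^`() * q - p * q^`())%:F / (q ^+ 2)%:F.
Proof.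
move=> q0; rewrite ratfun_deriv.unlock; set f := p%:F / q%:F.
have d0 : \d_(repr f) != 0 by exact: denom_ratioP.
have := ratfun_repr f; move: (\n_(repr f)) (\d_(repr f)) d0 => n d d0.
rewrite /f => /eqP; rewrite eqr_div ?tofrac_eq0 // -!tofracM tofrac_eq => /eqP e.
have de := congr1 (fun r => r^`()) e; rewrite /= !derivM in de.
apply/eqP; rewrite eqr_div ?tofrac_eq0 ?expf_neq0 // -!tofracM tofrac_eq; apply/eqP.
transitivity (q * d * (n^`() * q + n * q^`()) - (n * q) * (d * q^`() + d^`() * q)).
  by ring.
rewrite -de -e; ring.
Qed.

Lemma ratfun_derivD : {morph @ratfun_deriv K : f g / f + g}.
Proof.
move=> f g; rewrite (ratfun_repr f) (ratfun_repr g).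
move: (\n_(repr f)) (\d_(repr f)) (denom_ratioP (repr f)) => p q q0.
move: (\n_(repr g)) (\d_(repr g)) (denom_ratioP (repr g)) => r s s0.
rewrite addf_div ?tofrac_eq0 // -!tofracM -tofracD !ratfun_derivE ?mulf_neq0 //.
rewrite addf_div ?tofrac_eq0 ?expf_neq0 // -!tofracM -!tofracD.
apply/eqP; rewrite eqr_div ?tofrac_eq0 ?mulf_neq0 ?expf_neq0 // -!tofracM tofrac_eq.
by rewrite !derivD !derivM; apply/eqP; ring.
Qed.

Lemma ratfun_derivM (f g : ratfun K) :
  ratfun_deriv (f * g) = ratfun_deriv f * g + f * ratfun_deriv g.
Proof.
rewrite (ratfun_repr f) (ratfun_repr g).
move: (\n_(repr f)) (\d_(repr f)) (denom_ratioP (repr f)) => p q q0.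
move: (\n_(repr g)) (\d_(repr g)) (denom_ratioP (repr g)) => r s s0.
rewrite mulf_div -!tofracM !ratfun_derivE ?mulf_neq0 // !mulf_div -!tofracM.
rewrite addf_div ?tofrac_eq0 ?mulf_neq0 ?expf_neq0 // -!tofracM -!tofracD.
apply/eqP; rewrite eqr_div ?tofrac_eq0 ?mulf_neq0 ?expf_neq0 // -!tofracM tofrac_eq.
by rewrite !derivM; apply/eqP; ring.
Qed.

Lemma ratfun_deriv_poly (p : {poly K}) : ratfun_deriv p%:F = p^`()%:F.
Proof.
rewrite -[p%:F]divr1 -tofrac1 ratfun_derivE ?oner_eq0 //.
by rewrite -[1]polyC1 derivC mulr0 subr0 polyC1 mulr1 expr1n tofrac1 divr1.
Qed.

Lemma ratfun_derivZ (c : K) (f : ratfun K) :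
  ratfun_deriv (c *: f) = c *: ratfun_deriv f.
Proof.
by rewrite [LHS]ratfun_derivM ratfun_deriv_poly derivC tofrac0 mul0r add0r.
Qed.

End RatFun.
Arguments ratfun_t {K}.

Section RatFunInv.
Variable K : fieldType.

Lemma ratfun_deriv1 : ratfun_deriv (1 : ratfun K) = 0.
Proof. by rewrite -[1]tofrac1 ratfun_deriv_poly -[1]polyC1 derivC tofrac0. Qed.

Lemma ratfun_deriv_linear : linear (@ratfun_deriv K).
Proof. by move=> c f g; rewrite ratfun_derivD ratfun_derivZ. Qed.

Lemma ratfun_deriv_t : ratfun_deriv ratfun_t = 1 :> ratfun K.
Proof. by rewrite ratfun_deriv_poly derivX tofrac1. Qed.

Lemma ratfun_derivV (f : ratfun K) :
  ratfun_deriv f^-1 = - (f^-1 * f^-1 * ratfun_deriv f).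
Proof.
have [->|f0] := eqVneq f 0.
  have := ratfun_derivZ 0 (0 : ratfun K); rewrite !scale0r invr0 => ->.
  by rewrite mulr0 oppr0.
have := ratfun_derivM f f^-1; rewrite mulfV // ratfun_deriv1 => /esym/eqP.
rewrite addrC addr_eq0 => /eqP e; apply: (mulfI f0).
by rewrite e mulrN -mulrA mulVKf // mulrC.
Qed.

End RatFunInv.

Definition subalg_gen (K : fieldType) (A : algType K) (s : seq A) : {pred A} :=
  [pred f | `[< forall S : {pred A}, GRing.subalg_closed S ->
                 {subset s <= S} -> f \in S >]].

Section SubalgGen.
Variables (K : fieldType) (A : algType K) (s : seq A).

Lemma subalg_gen_closed : GRing.subalg_closed (subalg_gen s).
Proof.
split.
- by apply/asboolP => S [].
- move=> c f g /asboolP fS /asboolP gS; apply/asboolP => S Sc sS.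
  by case: (Sc) => _ + _; apply; [exact: fS | exact: gS].
- move=> f g /asboolP fS /asboolP gS; apply/asboolP => S Sc sS.
  by case: (Sc) => _ _; apply; [exact: fS | exact: gS].
Qed.

HB.instance Definition _ := GRing.isSubalgClosed.Build K A (subalg_gen s)
  (GRing.subalg_closed_semi subalg_gen_closed).

Lemma mem_subalg_gen : {subset s <= subalg_gen s}.
Proof. by move=> f fs; apply/asboolP => S _; apply. Qed.

End SubalgGen.

HB.mixin Record Lmodule_isLie (K : pzRingType) L of GRing.Lmodule K L := {
  lie : L -> L -> L;
  lie_linearl : forall z, linear (lie^~ z);
  lie_linearr : forall x, linear (lie x);
  liexx : forall x, lie x x = 0;
  lie_jacobi : forall x y z,
    lie x (lie y z) + lie y (lie z x) + lie z (lie x y) = 0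
}.

#[short(type="lieAlgType")]
HB.structure Definition LieAlgebra (K : pzRingType) :=
  {L of Lmodule_isLie K L & GRing.Lmodule K L}.

Definition lie_iso (K : pzRingType) (L L' : lieAlgType K) (psi : L -> L') :=
  [/\ linear psi, {morph psi : x y / lie x y} & bijective psi].

Definition derivation (K : fieldType) (A : algType K) : {pred A -> A} :=
  [pred D | `[< linear D /\ forall f g, D (f * g) = D f * g + f * D g >]].

Section Derivations.
Variables (K : fieldType) (A : algType K).

Lemma derivation_closed : GRing.submod_closed (derivation (A := A)).
Proof.
split=> [|c D E /asboolP[Dl DM] /asboolP[El EM]]; apply/asboolP; split.
- by move=> c f g; rewrite /= scaler0 addr0.
- by move=> f g; rewrite /= mul0r mulr0 addr0.
- move=> d f g /=; rewrite !fctE /= Dl El !scalerDr !scalerA (mulrC c d).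
  by rewrite addrACA.
- move=> f g /=; rewrite !fctE /= DM EM scalerDr !mulrDl !mulrDr.
  by rewrite scalerAl scalerAr addrACA.
Qed.

HB.instance Definition _ := GRing.isSubmodClosed.Build K (A -> A)
  (derivation (A := A)) derivation_closed.

Record Der := MkDer { der_fun :> A -> A; _ : der_fun \in derivation (A := A) }.

HB.instance Definition _ := [isSub for der_fun].
HB.instance Definition _ := [Choice of Der by <:].
HB.instance Definition _ := [SubChoice_isSubLmodule of Der by <:].

Implicit Types D E F : Der.

Lemma DerP D E : (forall f, D f = E f) -> D = E.
Proof. by move=> DE; apply: val_inj; apply/funext. Qed.

Lemma der_linear D : linear D.
Proof. by case: D => D /= /asboolP[]. Qed.

Lemma derM D f g : D (f * g) = D f * g + f * D g.
Proof. by case: D => D /= /asboolP[]. Qed.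

Lemma derD D f g : D (f + g) = D f + D g.
Proof. by have := der_linear D 1 f g; rewrite !scale1r. Qed.

Lemma der0 D : D 0 = 0.
Proof. by apply: (addrI (D 0)); rewrite -derD !addr0. Qed.

Lemma derZ D c f : D (c *: f) = c *: D f.
Proof. by have := der_linear D c f 0; rewrite der0 !addr0. Qed.

Lemma derN D f : D (- f) = - D f.
Proof. by rewrite -scaleN1r derZ scaleN1r. Qed.

Lemma add_derE D E f : (D + E) f = D f + E f. Proof. by []. Qed.
Lemma opp_derE D f : (- D) f = - D f. Proof. by []. Qed.
Lemma scale_derE c D f : (c *: D) f = c *: D f. Proof. by []. Qed.
Lemma zero_derE f : (0 : Der) f = 0. Proof. by []. Qed.

Lemma commutator_subproof D E :
  (fun f => D (E f) - E (D f)) \in derivation (A := A).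
Proof.
apply/asboolP; split=> [c f g|f g].
  by rewrite !(derD, derZ) scalerBr opprD addrACA.
rewrite !(derM, derD) mulrBl mulrBr (AC (2*2) ((1*4)*(2*3)))/=.
by rewrite [X in _ - X](AC (2*2) ((3*2)*(1*4)))/= addrKA opprD addrACA.
Qed.

Definition der_lie D E : Der := MkDer (commutator_subproof D E).

Lemma der_lieE D E f : der_lie D E f = D (E f) - E (D f). Proof. by []. Qed.

Lemma der_lie_linearl F : linear (der_lie^~ F).
Proof.
move=> c D E; apply: DerP => f.
rewrite add_derE scale_derE !der_lieE !add_derE !scale_derE derD derZ.
by rewrite scalerBr opprD addrACA.
Qed.

Lemma der_lie_linearr D : linear (der_lie D).
Proof.
move=> c E F; apply: DerP => f.
rewrite add_derE scale_derE !der_lieE !add_derE !scale_derE derD derZ.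
by rewrite scalerBr opprD addrACA.
Qed.

Lemma der_liexx D : der_lie D D = 0.
Proof. by apply: DerP => f; rewrite der_lieE zero_derE subrr. Qed.

Lemma der_lie_jacobi D E F :
  der_lie D (der_lie E F) + der_lie E (der_lie F D) + der_lie F (der_lie D E)
  = 0.
Proof.
apply: DerP => f; rewrite !add_derE zero_derE !der_lieE !(derD, derN) !opprB.
rewrite (AC ((2*2)*(2*2)*(2*2))
  ((1*12)*(7*2)*(3*10)*(5*4)*(11*6)*(9*8)))/=.
by rewrite !subrr !addr0.
Qed.

HB.instance Definition _ := Lmodule_isLie.Build K Der
  der_lie_linearl der_lie_linearr der_liexx der_lie_jacobi.

End Derivations.

Section Ra.
Variables (K : fieldType) (a : seq K).

Definition Ra_gens : seq (ratfun K) :=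
  ratfun_t :: [seq (ratfun_t - z%:A)^-1 | z <- a].

Lemma Ra_gensV z : z \in a -> (ratfun_t - z%:A)^-1 \in Ra_gens.
Proof. by move=> za; rewrite inE; apply/orP; right; apply/mapP; exists z. Qed.

Record Ra := MkRa { Ra_val :> ratfun K; _ : Ra_val \in subalg_gen Ra_gens }.

HB.instance Definition _ := [isSub for Ra_val].
HB.instance Definition _ := [Choice of Ra by <:].
HB.instance Definition _ := [SubChoice_isSubAlgebra of Ra by <:].

Lemma Ra_mulC : commutative (@GRing.mul Ra).
Proof. by move=> f g; apply: val_inj; rewrite !rmorphM mulrC. Qed.

HB.instance Definition _ := GRing.PzRing_hasCommutativeMul.Build Ra Ra_mulC.

(* A nonzero [f] is a unit of [R_a] iff its inverse in [K(t)] lies in [R_a];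
   otherwise [Ra_inv f] is [f], as MathComp requires. *)
Definition Ra_unit : {pred Ra} :=
  [pred f : Ra | (val f != 0) && ((val f)^-1 \in subalg_gen Ra_gens)].
Definition Ra_inv (f : Ra) : Ra := insubd f (val f)^-1.

Lemma Ra_mulVf : {in Ra_unit, left_inverse 1 Ra_inv *%R}.
Proof.
move=> f /andP[f0 fV]; apply: val_inj.
by rewrite rmorphM rmorph1 /= /Ra_inv insubdK // mulVf.
Qed.

Lemma Ra_unitPl (f g : Ra) : g * f = 1 -> Ra_unit f.
Proof.
move=> /(congr1 val) gf; have {}gf : val g * val f = 1 by [].
have f0 : val f != 0.
  by apply/eqP => f0; move: gf; rewrite f0 mulr0 => /esym/eqP; rewrite oner_eq0.
rewrite /Ra_unit /= f0 /=; suff -> : (val f)^-1 = val g by exact: valP.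
by apply: (mulIf f0); rewrite mulVf.
Qed.

Lemma Ra_inv_out : {in [predC Ra_unit], Ra_inv =1 id}.
Proof.
move=> f; rewrite inE /= negb_and negbK => /orP[/eqP f0|fV].
  have {f0} -> : f = 0 by exact/val_inj/f0.
  apply: val_inj; rewrite /Ra_inv invr0 insubdK //; exact: rpred0.
by apply: val_inj; rewrite val_insubd (negPf fV).
Qed.

HB.instance Definition _ := GRing.ComNzRing_hasMulInverse.Build Ra
  Ra_mulVf Ra_unitPl Ra_inv_out.

Lemma Ra_deriv_subproof (f : Ra) :
  ratfun_deriv (val f) \in subalg_gen Ra_gens.
Proof.
pose S : {pred ratfun K} :=
  [pred g | (g \in subalg_gen Ra_gens) && (ratfun_deriv g \in subalg_gen Ra_gens)].
suff : val f \in S by case/andP.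
have /asboolP := valP f; apply.
- split; first by rewrite inE rpred1 ratfun_deriv1 rpred0.
    move=> c g h /andP[gR g'R] /andP[hR h'R]; apply/andP.
    rewrite ratfun_deriv_linear; split; apply: rpredD => //; exact: rpredZ.
  move=> g h /andP[gR g'R] /andP[hR h'R]; apply/andP.
  rewrite ratfun_derivM; split; first exact: rpredM.
  by apply: rpredD; apply: rpredM.
- move=> g gS; apply/andP; split; first exact: mem_subalg_gen.
  move: gS; rewrite inE => /orP[/eqP ->|/mapP[z za ->]].
    by rewrite ratfun_deriv_t rpred1.
  have zR := mem_subalg_gen (Ra_gensV za).
  have d1 : ratfun_deriv (ratfun_t - z%:A) = 1 :> ratfun K.
    rewrite addrC -scaleNr ratfun_deriv_linear ratfun_deriv1 ratfun_deriv_t.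
    by rewrite scaler0 add0r.
  by rewrite ratfun_derivV d1 mulr1 rpredN; apply: rpredM.
Qed.

Definition Ra_deriv (f : Ra) : Ra := MkRa (Ra_deriv_subproof f).

Lemma vfield_subproof (f : Ra) :
  (fun g => f * Ra_deriv g) \in derivation (A := Ra).
Proof.
apply/asboolP; split=> [c g h|g h]; apply: val_inj.
  change (val f * ratfun_deriv (c *: val g + val h) =
    c *: (val f * ratfun_deriv (val g)) + val f * ratfun_deriv (val h)).
  by rewrite ratfun_deriv_linear mulrDr -scalerAr.
change (val f * ratfun_deriv (val g * val h) =
  val f * ratfun_deriv (val g) * val h + val g * (val f * ratfun_deriv (val h))).
by rewrite ratfun_derivM mulrDr mulrA; congr (_ + _); rewrite mulrCA.
Qed.

End Ra.

Notation Va a := (Der (Ra a)).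

Section Kinds.
Variable K : fieldType.
Implicit Types a b : seq K.

Definition Ra_t a : Ra a := MkRa (mem_subalg_gen (mem_head _ _)).

Lemma Ra_unitB a z : z \in a -> Ra_t a - z%:A \is a GRing.unit.
Proof.
move=> za; have zV := mem_subalg_gen (Ra_gensV za).
apply/andP; split; last exact: zV.
change (ratfun_t - z%:A != 0 :> ratfun K).
rewrite /ratfun_t /GRing.scale /= /ratfun_scale mulr1 -tofracB tofrac_eq0.
by rewrite polyXsubC_eq0.
Qed.

Definition vfield a (f : Ra a) : Va a := MkDer (vfield_subproof f).

Lemma vfield_lie a (f g : Ra a) :
  lie (vfield f) (vfield g) = vfield (f * Ra_deriv g - g * Ra_deriv f).
Proof.
apply: DerP => h; apply: val_inj.
change (val f * ratfun_deriv (val g * ratfun_deriv (val h)) -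
        val g * ratfun_deriv (val f * ratfun_deriv (val h)) =
        (val f * ratfun_deriv (val g) - val g * ratfun_deriv (val f)) *
        ratfun_deriv (val h)).
by rewrite !ratfun_derivM; ring.
Qed.

Lemma Va_vfield a (D : Va a) : D = vfield (D (Ra_t a)).
Proof.
apply/eqP; rewrite -subr_eq0; set E := D - _; apply/eqP.
have Et : E (Ra_t a) = 0.
  have t1 : Ra_deriv (Ra_t a) = 1 by apply: val_inj; exact: ratfun_deriv_t.
  change (D (Ra_t a) - D (Ra_t a) * Ra_deriv (Ra_t a) = 0).
  by rewrite t1 mulr1 subrr.
have E1 : E 1 = 0.
  by apply: (addrI (E 1)); rewrite addr0 -{3}[1]mulr1 derM mulr1 mul1r.
apply: DerP => f; rewrite zero_derE.
pose S : {pred ratfun K} := [pred g | `[< exists2 h : Ra a, val h = g & E h = 0 >]].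
suff /asboolP[h /val_inj -> //] : val f \in S.
have /asboolP := valP f; apply.
- split; first by apply/asboolP; exists 1.
    move=> c _ _ /asboolP[g <- g0] /asboolP[h <- h0]; apply/asboolP.
    by exists (c *: g + h); rewrite // derD derZ g0 h0 scaler0 addr0.
  move=> _ _ /asboolP[g <- g0] /asboolP[h <- h0]; apply/asboolP.
  by exists (g * h); rewrite // derM g0 h0 mul0r mulr0 addr0.
- move=> g; rewrite inE => /orP[/eqP ->|/mapP[z za ->]]; apply/asboolP.
    by exists (Ra_t a).
  have uU := Ra_unitB za; have zV := mem_subalg_gen (Ra_gensV za).
  exists (Ra_t a - z%:A)^-1; first by rewrite [LHS]insubdK.
  have := derM E (Ra_t a - z%:A) (Ra_t a - z%:A)^-1.
  rewrite divrr // E1 derD derN derZ Et E1 scaler0 oppr0 addr0 mul0r add0r.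
  by move=> /esym e; apply: (mulrI uU); rewrite e mulr0.
Qed.

(* Tuples are sequences, so the coordinate [a_1] is [a`_0];
   [b] is the reordering of [a']. *)
Definition first_kind a a' (psi : Va a -> Va a') : Prop :=
  [/\ lie_iso psi, size a = size a' &
  exists2 b, perm_eq b a' &
  exists2 c : K, c != 0 &
    (forall i, (i < size a)%N -> a`_i - a`_0 = c * (b`_i - b`_0)) /\
    (forall (k : int) i, (i < size a)%N ->
       psi (vfield ((Ra_t a - (a`_i)%:A) ^ k)) =
       c ^ (k - 1) *: vfield ((Ra_t a' - (b`_i)%:A) ^ k))].

Definition second_kind a a' (psi : Va a -> Va a') : Prop :=
  [/\ lie_iso psi, size a = size a' &
  exists b b', [/\ perm_eq b a, perm_eq b' a' &
  exists2 c : K, c != 0 &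
    [/\ forall i, (0 < i < size a)%N ->
          (b`_i - b`_0) * (b'`_i - b'`_0) = c,
        forall k : int,
          psi (vfield ((Ra_t a - (b`_0)%:A) ^ k)) =
          (- c ^ (k - 1)) *: vfield ((Ra_t a' - (b'`_0)%:A) ^ (2 - k)) &
        forall (k : int) i, (0 < i < size a)%N ->
          psi (vfield ((Ra_t a - (b`_i)%:A) ^ k)) =
          (- c^-1 * (b`_0 - b`_i) ^ k) *:
            vfield ((Ra_t a' - (b'`_i)%:A) ^ k *
                    (Ra_t a' - (b'`_0)%:A) ^ (2 - k))]]].

Definition distinct_tuple a : Prop := (0 < size a)%N /\ uniq a.

Local Open Scope classical_set_scope.

Definition frakC1 a : set (seq K) :=
  [set b | exists x y : K, x != 0 /\ b = [seq x * z + y | z <- a]].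

(* MathComp's field inverse satisfies [0^-1 = 0]. *)
Definition frakC2 a : set (seq K) :=
  [set b | exists (x y : K) (i : nat), [/\ x != 0, (i < size a)%N &
             b = [seq x * (z - a`_i)^-1 + y | z <- a]]].

(* [R_a] and [V_a] do not depend on the order of the coordinates of [a], so
   sets of tuples are compared up to reordering. *)
Definition reorderings (S : set (seq K)) : set (seq K) :=
  [set b | exists2 b0, S b0 & perm_eq b b0].

End Kinds.

(* Main.v *)
(* A Lie isomorphism psi is studied through lam f = psi (f d/dt)(t), an additive
   map from R_a to the field K(t) with
     lam (f g' - g f') = lam f (lam g)' - lam g (lam f)'.
   Extended K(t)-linearly to polynomials in t, its bracket form has rank at most
   2, so a nonzero polynomial Q of degree at most 4 satisfies lam (Q g) = 0 for
   all g. Bracketing with Q shows that Q' - c has the same property for some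
   constant c, and descending on the degree gives a linear relation, that is
   lam (t g) = phi * lam g for a single rational function phi. Then
   lam 1 = 1 / phi', and since psi^-1 has a multiplier too, phi is a fractional
   linear transformation. Whether or not phi is affine, comparing poles of lam 1,
   lam (t^3) and lam ((t - a_i)^-1) matches the points of a and a'. *)
From HB Require Import structures.
Require Import Defs.
From mathcomp Require Import all_boot all_order all_algebra.
From mathcomp Require Import fraction ring.
From mathcomp Require Import boolp classical_sets reals complex.

Set Implicit Arguments.
Unset Strict Implicit.
Unset Printing Implicit Defensive.

Import Order.TTheory GRing.Theory Num.Theory.
Local Open Scope ring_scope.
Local Open Scope classical_set_scope.

Section Pairing.
Variable F : fieldType.
Implicit Types (u v : nat -> F) (Q : {poly F}).

Definition pairing u Q : F := \sum_(i < size Q) Q`_i * u i.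

Lemma pairing_widen n u Q : (size Q <= n)%N ->
  pairing u Q = \sum_(i < n) Q`_i * u i.
Proof.
move=> leQn; rewrite /pairing (big_ord_widen _ (fun i => Q`_i * u i) leQn).
rewrite [RHS](bigID (fun i : 'I_n => i < size Q)%N) /=.
rewrite [X in _ = _ + X]big1 ?addr0 //.
by move=> i; rewrite -leqNgt => /(nth_default 0) ->; rewrite mul0r.
Qed.

Lemma eq_pairing u v Q : u =1 v -> pairing u Q = pairing v Q.
Proof. by move=> uv; apply: eq_bigr => i _; rewrite uv. Qed.

Lemma pairingD u Q S : pairing u (Q + S) = pairing u Q + pairing u S.
Proof.
pose n := maxn (size Q) (size S).
rewrite (pairing_widen u (size_polyD Q S : _ <= n)%N).
rewrite !(@pairing_widen n) ?leq_maxl ?leq_maxr // -big_split.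
by apply: eq_bigr => i _; rewrite coefD mulrDl.
Qed.

Lemma pairingC u c : pairing u c%:P = c * u 0%N.
Proof.
by rewrite (@pairing_widen 1) ?size_polyC_leq1 // big_ord1 coefC.
Qed.

Lemma pairingMX u Q : pairing u ('X * Q) = pairing (u \o succn) Q.
Proof.
rewrite (@pairing_widen (size Q).+1); last first.
  by rewrite mulrC (leq_trans (size_polyMleq _ _)) // size_polyX addn2.
rewrite big_ord_recl coefXM mul0r add0r.
by apply: eq_bigr => i _; rewrite coefXM.
Qed.

Lemma pairing_deriv u Q :
  pairing u Q^`() = pairing (fun i => i%:R * u i.-1) Q.
Proof.
rewrite (@pairing_widen (size Q)); last first.
  by rewrite (leq_trans (size_poly _ _)) // leq_pred.
rewrite [RHS](@pairing_widen (size Q).+1) //.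
rewrite big_ord_recl mul0r mulr0 add0r.
by apply: eq_bigr => i _; rewrite coef_deriv /= mulrA mulr_natr.
Qed.

Lemma exists_pairing_eq0 (s : seq (nat -> F)) :
  exists2 Q : {poly F}, Q != 0 &
    forall i, (i < size s)%N -> pairing (nth (fun=> 0) s i) Q = 0.
Proof.
pose M := \matrix_(k < (size s).+1, i < size s) nth (fun=> 0) s i k.
have : kermx M != 0.
  by rewrite kermx_eq0 /row_free neq_ltn ltnS rank_leq_col.
move=> /rowV0Pn[v /sub_kermxP vM v0]; exists (rVpoly v).
  by apply: contra v0 => /eqP v0; rewrite -[v]rVpolyK v0 linear0.
move=> i lt_i; rewrite (@pairing_widen (size s).+1) ?size_poly //.
move: vM => /matrixP/(_ 0 (Ordinal lt_i)); rewrite !mxE => vM; rewrite -[RHS]vM.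
by apply: eq_bigr => k _; rewrite coef_rVpoly_ord mxE.
Qed.

End Pairing.

Section Semilinear.
Variables (A : comPzRingType) (F : fieldType) (t : A) (D : A -> A) (d : F -> F).
Variable lam : {additive A -> F}.
Hypothesis F0 : [pchar F] =i pred0.
Hypothesis derM : forall f g, D (f * g) = D f * g + f * D g.
Hypothesis dert : D t = 1.
Hypothesis lamB :
  forall f g, lam (f * D g - g * D f) = lam f * d (lam g) - lam g * d (lam f).

Local Notation L g := (pairing (fun i => lam (t ^+ i * g))).
Local Notation X := (pairing (fun i => d (lam (t ^+ i)))).

Let der1 : D 1 = 0.
Proof.
have := derM 1 1; rewrite !mulr1 mul1r => /eqP.
by rewrite -subr_eq0 opprD addNKr oppr_eq0 => /eqP.
Qed.

Let derX n : D (t ^+ n) = n%:R * t ^+ n.-1.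
Proof.
elim: n => [|n IHn]; first by rewrite expr0 der1 mul0r.
rewrite exprS derM IHn dert mul1r; case: n {IHn} => [|n] /=.
  by rewrite !mul0r mulr0 addr0 expr0 mul1r.
rewrite exprS [_.+2%:R]mulrS; ring.
Qed.

Let lam_nat n g : lam (n%:R * g) = n%:R * lam g.
Proof. by rewrite !mulr_natl raddfMn. Qed.

Lemma pairing_bracket g Q :
  L (D g) Q - L g Q^`() = L 1 Q * d (lam g) - lam g * X Q.
Proof.
rewrite pairing_deriv /pairing mulr_suml mulr_sumr -!sumrB.
apply: eq_bigr => i _; rewrite -mulrBr mulr1.
have := lamB (t ^+ i) g; rewrite derX raddfB /= [g * _]mulrC -!mulrA lam_nat.
by move=> ->; ring.
Qed.

Lemma pairing_shift g Q : L g ('X * Q) = L (t * g) Q.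
Proof.
by rewrite pairingMX; apply: eq_pairing => i /=; rewrite exprSr mulrA.
Qed.

Lemma exists_annihilator : exists2 Q : {poly F}, Q != 0 & forall g, L g Q = 0.
Proof.
have [Q Q0 Qker] := exists_pairing_eq0 [:: (fun i => lam (t ^+ i * 1));
  (fun i => d (lam (t ^+ i))); (fun i => lam (t ^+ i * 1)) \o succn;
  (fun i => d (lam (t ^+ i))) \o succn].
have L1 : L 1 Q = 0 by exact: (Qker 0%N).
have XQ : X Q = 0 by exact: (Qker 1%N).
have LM : L 1 ('X * Q) = 0 by rewrite pairingMX; exact: (Qker 2%N).
have XM : X ('X * Q) = 0 by rewrite pairingMX; exact: (Qker 3%N).
exists Q => // g.
have := pairing_bracket (t * g) Q.
have := pairing_bracket g ('X * Q).
rewrite L1 LM XQ XM !mul0r !mulr0 !subr0 derivM derivX mul1r pairingD.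
rewrite !pairing_shift derM dert mul1r.
have -> : L (g + t * D g) Q = L g Q + L (t * D g) Q.
  rewrite -big_split; apply: eq_bigr => i _ /=.
  by rewrite mulrDr raddfD mulrDr.
move=> /eqP; rewrite subr_eq0 => /eqP -> /eqP.
rewrite addrA addrK -mulr2n -mulr_natr mulf_eq0 (proj1 (pcharf0P F) F0) orbF.
by move=> /eqP.
Qed.

Theorem multiplier_exists : exists phi, forall g, lam (t * g) = phi * lam g.
Proof.
have [Q Q0 LQ] := exists_annihilator.
have [n] := ubnP (size Q); elim: n Q Q0 LQ => // n IHn Q Q0 LQ leQn.
have [le2|] := leqP (size Q) 2; last first.
  case sizeQ: (size Q) leQn => [|[|[|m]]] // ltmn _.
  apply: (IHn (Q^`() + (- X Q)%:P)).
  - apply/eqP => /(congr1 (fun S : {poly F} => S`_m.+1)).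
    rewrite coefD coef_deriv coefC addr0 coef0 => /eqP.
    rewrite -mulr_natr mulf_eq0 (proj1 (pcharf0P F) F0) orbF.
    by apply/negP; rewrite -lead_coef_eq0 lead_coefE sizeQ in Q0.
  - move=> g; rewrite pairingD pairingC.
    have := pairing_bracket g Q; rewrite !LQ mul0r !sub0r expr0 mul1r mulrC.
    by move=> /eqP; rewrite eqr_opp => /eqP ->; rewrite mulNr subrr.
  - apply: (@leq_trans m.+3) => //; rewrite ltnS.
    apply: leq_trans (size_polyD _ _) _.
    rewrite geq_max (leq_trans (size_polyC_leq1 _)) // andbT.
    by rewrite (leq_trans (size_poly _ _)) // sizeQ.
have e g : Q`_0 * lam g + Q`_1 * lam (t * g) = 0.
  have := LQ g; rewrite (@pairing_widen _ 2) // big_ord_recl big_ord1 /=.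
  by rewrite expr0 mul1r expr1.
exists (- Q`_0 / Q`_1) => g.
have [Q10|Q10] := eqVneq Q`_1 0; last first.
  apply: (mulfI Q10); apply/eqP; rewrite mulrA mulrCA mulfV // mulr1 mulNr.
  by rewrite -addr_eq0 addrC e.
have Q00 : Q`_0 != 0.
  apply: contra Q0 => /eqP Q00; apply/eqP/polyP => -[|[|i]]; rewrite coef0 //.
  by rewrite nth_default // (leq_trans le2).
have l0 f : lam f = 0.
  by have /eqP := e f; rewrite Q10 mul0r addr0 mulf_eq0 (negPf Q00) => /eqP.
by rewrite !l0 mulr0.
Qed.

End Semilinear.

Local Notation "p %:F" := (@FracField.tofrac {poly _} p : ratfun _) : ring_scope.

Section Ratfun.
Variable K : fieldType.
Implicit Types (p P Q A B : {poly K}) (f phi : ratfun K) (a : seq K).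

Lemma alg_tofrac (c : K) : c%:A = c%:P%:F :> ratfun K.
Proof. exact: mulr1. Qed.

Lemma scale_tofrac (c : K) f : c *: f = c%:P%:F * f.
Proof. by []. Qed.

Lemma ratfun_coprime f :
  exists P Q, [/\ Q != 0, coprimep P Q & f = P%:F / Q%:F].
Proof.
rewrite (ratfun_repr f); move: (\n_(repr f)) (denom_ratioP (repr f)) => P.
move: (\d_(repr f)) => Q Q0; set g := gcdp P Q.
have g0 : g != 0 by rewrite gcdp_eq0 negb_and Q0 orbT.
have defP : P = (P %/ g) * g by rewrite divpK ?dvdp_gcdl.
have defQ : Q = (Q %/ g) * g by rewrite divpK ?dvdp_gcdr.
have Qg0 : Q %/ g != 0 by apply: contraNneq Q0 => e; rewrite defQ e mul0r.
exists (P %/ g), (Q %/ g); split=> //.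
  by apply: coprimep_div_gcd; rewrite Q0 orbT.
by rewrite {1}defP {1}defQ !tofracM -mulf_div divff ?mulr1 // tofrac_eq0.
Qed.

Definition transcendental phi := forall p, horner_alg phi p = 0 -> p = 0.

Lemma horner_alg_homog P Q A n : Q != 0 -> (size A <= n.+1)%N ->
  horner_alg (P%:F / Q%:F) A * (Q ^+ n)%:F
    = (\sum_(i < n.+1) A`_i *: (P ^+ i * Q ^+ (n - i)))%:F.
Proof.
move=> Q0 leAn; rewrite -[A in LHS]coefK poly_def rmorph_sum /= raddf_sum /=.
rewrite (big_ord_widen _ (fun i => horner_alg _ (A`_i *: 'X^i)) leAn).
rewrite mulr_suml [RHS](bigID (fun i : 'I_n.+1 => i < size A)%N) /=.
rewrite [X in _ = _ + X]big1 ?addr0; last first.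
  by move=> i; rewrite -leqNgt => /(nth_default 0) ->; rewrite scale0r tofrac0.
apply: eq_bigr => i _; rewrite linearZ rmorphXn /= horner_algX.
rewrite -mul_polyC tofracM scale_tofrac -mulrA; congr (_ * _); first exact: mulr1.
have QF0 : Q%:F != 0 by rewrite tofrac_eq0.
have le_in : (i <= n)%N by rewrite -ltnS.
rewrite tofracM !tofracXn expr_div_n.
rewrite -[X in _ * _ ^+ X = _](subnKC le_in).
by rewrite exprD mulrA divfK ?expf_neq0.
Qed.

(* Clearing denominators in [t * B(P / Q) = A(P / Q)], all terms but the last
   are divisible by [Q], and all terms but the first by [P]. *)
Lemma linear_fractional_size phi A B : transcendental phi -> B != 0 ->
  ratfun_t * horner_alg phi B = horner_alg phi A ->
  exists P Q, [/\ (size P <= 2)%N, (size Q <= 2)%N, Q != 0 & phi = P%:F / Q%:F].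
Proof.
move=> tr B0 eqAB; set g := gcdp A B.
have g0 : g != 0 by rewrite gcdp_eq0 negb_and B0 orbT.
have defA : A = (A %/ g) * g by rewrite divpK ?dvdp_gcdl.
have defB : B = (B %/ g) * g by rewrite divpK ?dvdp_gcdr.
have {eqAB} : ratfun_t * horner_alg phi (B %/ g) = horner_alg phi (A %/ g).
  have gphi : horner_alg phi g != 0 by apply: contra g0 => /eqP/tr ->.
  by apply: (mulIf gphi); rewrite -mulrA -!rmorphM /= -defA -defB.
have : coprimep (A %/ g) (B %/ g) by apply: coprimep_div_gcd; rewrite B0 orbT.
have : B %/ g != 0.
  by apply: contraNneq B0 => e; rewrite defB e mul0r.
clearbody g; move: (A %/ g) (B %/ g) => {B0 defA defB g0 g} {}A {}B B0 coAB eqAB.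
have [P [Q [Q0 coPQ defphi]]] := ratfun_coprime phi.
have P0 : P != 0.
  apply/eqP => P0; have := polyX_eq0 K; rewrite (tr 'X) ?eqxx //.
  by rewrite horner_algX defphi P0 tofrac0 mul0r.
exists P, Q.
pose L i : {poly K} := (A`_i)%:P - 'X * (B`_i)%:P.
have sizeL i : (size (L i) <= 2)%N.
  rewrite (leq_trans (size_polyD _ _)) // geq_max size_polyN mulrC mul_polyC.
  rewrite (leq_trans (size_polyC_leq1 _)) //.
  by rewrite (leq_trans (size_scale_leq _ _)) ?size_polyX.
have L0 i : L i = 0 -> A`_i = 0 /\ B`_i = 0.
  move=> Li0; split.
    by move/polyP/(_ 0%N): Li0; rewrite coef0 coefB coefC coefXM subr0.
  move/polyP/(_ 1%N): Li0; rewrite coef0 coefB coefC coefXM coefC sub0r.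
  by move/eqP; rewrite oppr_eq0 => /eqP.
pose n := (maxn (size A) (size B)).-1.
have n1 : n.+1 = maxn (size A) (size B).
  by rewrite prednK // leq_max orbC size_poly_gt0 B0.
have sum0 : \sum_(i < n.+1) L i * (P ^+ i * Q ^+ (n - i)) = 0.
  under eq_bigr do rewrite mulrBl -mulrA !mul_polyC.
  rewrite sumrB -mulr_sumr; apply/eqP; rewrite subr_eq0 -tofrac_eq tofracM.
  rewrite -!horner_alg_homog // ?n1 ?leq_maxl ?leq_maxr // -defphi mulrA.
  by rewrite [tofrac 'X * _]eqAB.
have co i m : coprimep (P ^+ i) (Q ^+ m) by rewrite coprimep_expl ?coprimep_expr.
split=> //.
- apply: leq_trans (sizeL 0%N); apply: dvdp_leq.
    apply/eqP => /L0[A00 B00].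
    have /(coprimep_root coAB) : root A 0 by rewrite rootE horner_coef0 A00.
    by rewrite horner_coef0 B00 eqxx.
  have := co 1%N n; rewrite expr1 => /Gauss_dvdpl <-.
  move: sum0; rewrite big_ord_recl subn0 mul1r => /eqP; rewrite addr_eq0.
  move=> /eqP ->; rewrite dvdpNr.
  apply: (big_ind (fun S => P %| S)); first exact: dvdp0.
    by move=> x y; apply: dvdp_add.
  by move=> i _; rewrite exprS -!mulrA dvdp_mull // dvdp_mulr.
- apply: leq_trans (sizeL n); apply: dvdp_leq.
    apply/eqP => /L0[An Bn].
    have [sAB|sBA] := leqP (size A) (size B).
      have : lead_coef B = 0 by rewrite lead_coefE -[RHS]Bn /n (maxn_idPr sAB).
      by move/eqP; rewrite lead_coef_eq0; apply/negP.
    have : lead_coef A = 0.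
      by rewrite lead_coefE -[RHS]An /n (maxn_idPl (ltnW sBA)).
    by move/eqP; rewrite lead_coef_eq0 => /eqP A0; rewrite A0 size_poly0 in sBA.
  have := co n 1%N; rewrite expr1 coprimep_sym => /Gauss_dvdpl <-.
  move: sum0; rewrite big_ord_recr /= subnn mulr1 addrC => /eqP; rewrite addr_eq0.
  move=> /eqP ->; rewrite dvdpNr.
  apply: (big_ind (fun S => Q %| S)); first exact: dvdp0.
    by move=> x y; apply: dvdp_add.
  move=> i _; rewrite -(subnSK (ltn_ord i)) exprS.
  by rewrite dvdp_mull // dvdp_mull // dvdp_mulr.
Qed.

End Ratfun.

Lemma linear_fractional_canonical (F : fieldType) (p0 p1 q0 q1 x : F) :
  q1 != 0 -> q1 * x + q0 != 0 ->
  (p1 * x + p0) / (q1 * x + q0)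
    = p1 / q1 + (p0 - p1 / q1 * q0) / q1 / (x - (- q0 / q1)).
Proof.
by move=> q10 Q0; field; rewrite q10 opprK mulrC.
Qed.

Section LinearFractional.
Variable K : fieldType.
Implicit Types (p P Q A B : {poly K}) (f phi : ratfun K) (a : seq K).
Local Notation t := (ratfun_t : ratfun K).

Lemma transcendental_neq_alg phi (c : K) : transcendental phi -> phi != c%:A.
Proof.
move=> tr; apply/eqP => e; have := polyXsubC_eq0 c.
by rewrite (tr ('X - c%:P)) ?eqxx // rmorphB /= horner_algX horner_algC e subrr.
Qed.

Lemma size2_poly P : (size P <= 2)%N ->
  P%:F = (P`_1)%:A * t + (P`_0)%:A :> ratfun K.
Proof.
move=> leP2; rewrite !alg_tofrac -tofracM -tofracD; congr tofrac.
apply/polyP => -[|[|i]]; rewrite coefD coefCM coefX coefC;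
  rewrite ?mulr0 ?add0r ?addr0 ?mulr1 //=.
by rewrite nth_default // (leq_trans leP2).
Qed.

Lemma linear_fractional phi A B : transcendental phi -> B != 0 ->
  t * horner_alg phi B = horner_alg phi A ->
  (exists x y : K, x != 0 /\ phi = x%:A * t + y%:A) \/
  (exists q r s : K, s != 0 /\ phi = r%:A + s%:A / (t - q%:A)).
Proof.
move=> tr B0 /(linear_fractional_size tr B0)[P [Q [leP leQ Q0 defphi]]].
have {Q0} : Q%:F != 0 :> ratfun K by rewrite tofrac_eq0.
move: defphi; rewrite (size2_poly leP) (size2_poly leQ).
move: P`_0 P`_1 Q`_0 Q`_1 => p0 p1 q0 q1 {leP leQ}.
pose i : {rmorphism K -> ratfun K} := in_alg (ratfun K).
have iE c : c%:A = i c by [].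
rewrite !iE; have [->|q10] := eqVneq q1 0.
  rewrite rmorph0 mul0r add0r fmorph_eq0 => defphi q00; left.
  have {}defphi : phi = (p1 / q0)%:A * t + (p0 / q0)%:A.
    by rewrite defphi !iE !rmorphM !fmorphV mulrDl [in LHS]mulrAC.
  exists (p1 / q0), (p0 / q0); split=> //.
  apply: contraTneq (transcendental_neq_alg (p0 / q0) tr) => x0.
  by rewrite defphi x0 scale0r mul0r add0r eqxx.
move=> defphi Q0; right.
exists (- q0 / q1), (p1 / q1), ((p0 - p1 / q1 * q0) / q1).
set s := _ / q1; set r := p1 / q1; set q := - q0 / q1.
have {}defphi : phi = r%:A + s%:A / (t - q%:A).
  rewrite defphi /s /r /q !iE.
  rewrite !(rmorphM, rmorphB, rmorphN, fmorphV).
  by apply: linear_fractional_canonical; rewrite ?fmorph_eq0.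
split=> //.
apply: contraTneq (transcendental_neq_alg r tr) => s0.
by rewrite defphi s0 scale0r mul0r addr0 eqxx.
Qed.

Lemma Ra_fraction a (f : Ra a) :
  exists A B, [/\ B != 0, {subset root B <= a} & val f * B%:F = A%:F].
Proof.
pose S : {pred ratfun K} := [pred g | `[< exists A B,
  [/\ B != 0, {subset root B <= a} & g * B%:F = A%:F] >]].
suff /asboolP : val f \in S by [].
have rootM_sub (B D : {poly K}) : {subset root B <= a} -> {subset root D <= a} ->
    {subset root (B * D) <= a}.
  by move=> Ba Da z; rewrite -topredE /= rootM => /orP[/Ba|/Da].
have one0 : (1 : {poly K}) != 0 by exact: oner_neq0.
have onea : {subset root (1 : {poly K}) <= a}.
  by move=> z; rewrite -topredE /= rootE hornerE oner_eq0.
have /asboolP := valP f; apply.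
- split.
  + by apply/asboolP; exists 1, 1; split=> //; rewrite mulr1.
  + move=> c g h /asboolP[A [B [B0 Ba e]]] /asboolP[A' [B' [B0' Ba' e']]].
    apply/asboolP; exists (c%:P * (A * B') + A' * B), (B * B'); split.
    * by rewrite mulf_neq0.
    * exact: rootM_sub.
    * by rewrite tofracD !tofracM -e -e' scale_tofrac; ring.
  + move=> g h /asboolP[A [B [B0 Ba e]]] /asboolP[A' [B' [B0' Ba' e']]].
    apply/asboolP; exists (A * A'), (B * B'); split.
    * by rewrite mulf_neq0.
    * exact: rootM_sub.
    * by rewrite !tofracM -e -e'; ring.
- move=> g; rewrite inE => /orP[/eqP ->|/mapP[z za ->]]; apply/asboolP.
    by exists 'X, 1; rewrite mulr1; split.
  exists 1, ('X - z%:P); split.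
  + by rewrite polyXsubC_eq0.
  + by move=> w; rewrite -topredE /= root_XsubC => /eqP ->.
  + by rewrite alg_tofrac -tofracB mulVf // tofrac_eq0 polyXsubC_eq0.
Qed.

Lemma Ra_pole a (f : Ra a) P Q (z : K) :
  val f * Q%:F = P%:F -> root Q z -> P.[z] != 0 -> z \in a.
Proof.
have [A [B [B0 Ba e]]] := Ra_fraction f => e' /rootP Qz Pz.
apply: Ba; rewrite -topredE /= rootE.
have /(congr1 (fun p => p.[z])) : A * Q = P * B.
  apply/eqP; rewrite -tofrac_eq !tofracM -e -e'; apply/eqP; ring.
rewrite !hornerM Qz mulr0 => /esym/eqP.
by rewrite mulf_eq0 (negPf Pz).
Qed.

End LinearFractional.

Section BracketMaps.
Variable K : fieldType.
Implicit Types (a : seq K) (phi : ratfun K).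

Definition bracket_map a a' (mu : Ra a -> Ra a') :=
  [/\ linear mu, bijective mu & forall f g,
    mu (f * Ra_deriv g - g * Ra_deriv f)
      = mu f * Ra_deriv (mu g) - mu g * Ra_deriv (mu f)].

Lemma Ra_derivM a (f g : Ra a) :
  Ra_deriv (f * g) = Ra_deriv f * g + f * Ra_deriv g.
Proof.
apply: val_inj; change (ratfun_deriv (val f * val g) =
  ratfun_deriv (val f) * val g + val f * ratfun_deriv (val g)).
exact: ratfun_derivM.
Qed.

Lemma Ra_deriv_t a : Ra_deriv (Ra_t a) = 1.
Proof. by apply: val_inj; exact: ratfun_deriv_t. Qed.

Lemma vfield_linear a : linear (@vfield K a).
Proof.
move=> c f g; apply: DerP => h.
by rewrite add_derE scale_derE /= mulrDl scalerAl.
Qed.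

Lemma vfield_t a (f : Ra a) : vfield f (Ra_t a) = f.
Proof.
apply: val_inj; change (val f * ratfun_deriv ratfun_t = val f).
by rewrite ratfun_deriv_t mulr1.
Qed.

Lemma vfield_inj a : injective (@vfield K a).
Proof. by move=> f g e; rewrite -[f]vfield_t e vfield_t. Qed.

Lemma bracket_map_of_lie_iso a a' (psi : Va a -> Va a') : lie_iso psi ->
  bracket_map (fun f => psi (vfield f) (Ra_t a')).
Proof.
move=> [psi_lin psi_lie [chi psiK chiK]]; split.
- by move=> c f g; rewrite vfield_linear psi_lin.
- exists (fun f => chi (vfield f) (Ra_t a)) => f.
    by rewrite -Va_vfield psiK vfield_t.
  by rewrite -Va_vfield chiK vfield_t.
- move=> f g; apply: vfield_inj; rewrite -Va_vfield -vfield_lie psi_lie.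
  rewrite [psi (vfield f)]Va_vfield [psi (vfield g)]Va_vfield.
  by rewrite vfield_lie !vfield_t.
Qed.

Lemma lie_iso_of_bracket_map a a' (mu : Ra a -> Ra a') : bracket_map mu ->
  lie_iso (fun D : Va a => vfield (mu (D (Ra_t a))) : Va a').
Proof.
move=> [mu_lin [nu muK nuK] mu_lie]; split.
- by move=> c D E; rewrite -vfield_linear -mu_lin.
- move=> D E; rewrite vfield_lie -mu_lie; congr (vfield (mu _)).
  by rewrite {1}[D]Va_vfield {1}[E]Va_vfield vfield_lie vfield_t.
- apply: (@Bijective (Va a') (Va a) _ (fun D => vfield (nu (D (Ra_t a'))))) => D.
    by rewrite vfield_t muK -Va_vfield.
  by rewrite vfield_t nuK -Va_vfield.
Qed.

Lemma bracket_map_inv a a' (mu : Ra a -> Ra a') (nu : Ra a' -> Ra a) :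
  bracket_map mu -> cancel mu nu -> cancel nu mu -> bracket_map nu.
Proof.
move=> [mu_lin _ mu_lie] muK nuK; have mu_inj := can_inj muK; split.
- by move=> c f g; apply: mu_inj; rewrite mu_lin !nuK.
- by exists mu.
- by move=> f g; apply: mu_inj; rewrite mu_lie !nuK.
Qed.

Section Multiplier.
Variables (a a' : seq K) (mu : Ra a -> Ra a').
Hypothesis mu_map : bracket_map mu.
Hypothesis K0 : [pchar K] =i pred0.

Let mu_lin : linear mu. Proof. by case: mu_map. Qed.
Let mu_inj : injective mu. Proof. by case: mu_map => _ /bij_inj. Qed.
HB.instance Definition _ := GRing.isLinear.Build K (Ra a) (Ra a') _ mu mu_lin.

Let mu_bracketE f g : val (mu (f * Ra_deriv g - g * Ra_deriv f))
  = val (mu f) * ratfun_deriv (val (mu g))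
    - val (mu g) * ratfun_deriv (val (mu f)).
Proof. by case: mu_map => _ _ /(_ f g) /(congr1 val). Qed.

Lemma bracket_map_semilinear :
  exists phi, forall g, val (mu (Ra_t a * g)) = phi * val (mu g).
Proof.
pose lam : {additive Ra a -> ratfun K} := (val : Ra a' -> ratfun K) \o mu.
have := @multiplier_exists _ _ (Ra_t a) (@Ra_deriv K a) (@ratfun_deriv K) lam.
apply.
- move=> p; rewrite (fmorph_pchar (in_alg (ratfun K))); exact: K0.
- exact: Ra_derivM.
- exact: Ra_deriv_t.
- exact: mu_bracketE.
Qed.

Variable phi : ratfun K.
Hypothesis muM : forall g, val (mu (Ra_t a * g)) = phi * val (mu g).

Let mu_linE c f g : val (mu (c *: f + g)) = c *: val (mu f) + val (mu g).
Proof. by rewrite mu_lin. Qed.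

Let mu0 : mu 0 = 0.
Proof. exact: (raddf0 mu). Qed.

Lemma bracket_map_horner p g :
  val (mu (horner_alg (Ra_t a) p * g)) = horner_alg phi p * val (mu g).
Proof.
elim/poly_ind: p g => [|p c IHp] g.
  by rewrite !rmorph0 !mul0r mu0.
rewrite !rmorphD !rmorphM /= !horner_algX !horner_algC mulrDl -mulrA addrC.
rewrite mulr_algl mu_linE IHp muM [RHS]mulrDl mulr_algl mulrA.
exact: addrC.
Qed.

Lemma val_horner_t (b : seq K) p : val (horner_alg (Ra_t b) p) = p%:F.
Proof.
elim/poly_ind: p => [|p c IHp]; first by rewrite !rmorph0.
rewrite !rmorphD !rmorphM /= !horner_algX horner_algC IHp; congr (_ + _).
exact: alg_tofrac.
Qed.

Lemma bracket_map_transcendental : transcendental phi.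
Proof.
move=> p p0; have := bracket_map_horner p 1; rewrite p0 mul0r.
rewrite -[0]/(val (0 : Ra a')) => /val_inj; rewrite -mu0.
move/mu_inj/(congr1 val); rewrite mulr1 val_horner_t => /eqP.
by rewrite tofrac_eq0 => /eqP.
Qed.

Lemma bracket_map_one : val (mu 1) * ratfun_deriv phi = 1.
Proof.
have d1 : Ra_deriv 1 = 0 :> Ra a by apply: val_inj; exact: ratfun_deriv1.
have := mu_bracketE 1 (Ra_t a).
have -> : 1 * Ra_deriv (Ra_t a) - Ra_t a * Ra_deriv 1 = 1 :> Ra a.
  by rewrite d1 mulr0 subr0 mul1r Ra_deriv_t.
have h0 : val (mu 1) != 0.
  rewrite -[0]/(val (0 : Ra a')) (inj_eq val_inj) -mu0 (inj_eq mu_inj).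
  exact: oner_neq0.
rewrite -[Ra_t a]mulr1 muM ratfun_derivM; move: (val (mu 1)) h0 => h h0 e.
by apply: (mulfI h0); rewrite mulr1 [RHS]e; ring.
Qed.

End Multiplier.

End BracketMaps.

Lemma inversion_cube (F : fieldType) (R S T h : F) : S != 0 -> T != 0 ->
  h * (- S / T ^+ 2) = 1 -> (R + S / T) ^+ 3 * h * (S * T) = - (R * T + S) ^+ 3.
Proof.
move=> S0 T0 e1; have -> : h = - T ^+ 2 / S.
  apply: (mulIf (_ : - S / T ^+ 2 != 0)).
    by rewrite mulf_neq0 ?oppr_eq0 ?invr_eq0 ?expf_neq0.
  by rewrite e1; field; rewrite S0 T0.
by field; rewrite S0 T0.
Qed.

Lemma inversion_quotient (F : fieldType) (R S T Z g h : F) : T != 0 ->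
  (R + S / T - Z) * g = h -> h * (- S / T ^+ 2) = 1 ->
  g * (S * ((R - Z) * T + S)) = - T ^+ 3.
Proof.
move=> T0 <- e1.
have -> : - T ^+ 3 = (R + S / T - Z) * g * (- S / T ^+ 2) * - T ^+ 3.
  by rewrite e1 mul1r.
by field; rewrite T0.
Qed.

Section PolesOfMultipliers.
Variable K : fieldType.
Implicit Types (a : seq K) (phi : ratfun K).
Local Notation t := (ratfun_t : ratfun K).

Lemma ratfun_deriv_alg (c : K) : ratfun_deriv (c%:A : ratfun K) = 0.
Proof. by rewrite alg_tofrac ratfun_deriv_poly derivC tofrac0. Qed.

Lemma ratfun_derivMalg (c : K) (f : ratfun K) :
  ratfun_deriv (c%:A * f) = c%:A * ratfun_deriv f.
Proof. by rewrite ratfun_derivM ratfun_deriv_alg mul0r add0r. Qed.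

Lemma ratfun_deriv_affine (x y : K) : ratfun_deriv (x%:A * t + y%:A) = x%:A.
Proof.
rewrite ratfun_derivD ratfun_derivMalg ratfun_deriv_alg ratfun_deriv_t.
by rewrite mulr1 addr0.
Qed.

Lemma t_sub_alg (c : K) : t - c%:A = ('X - c%:P)%:F.
Proof. by rewrite alg_tofrac tofracB. Qed.

Lemma t_sub_alg_neq0 (c : K) : t - c%:A != 0.
Proof. by rewrite t_sub_alg tofrac_eq0 polyXsubC_eq0. Qed.

Lemma ratfun_deriv_inversion (q r s : K) :
  ratfun_deriv (r%:A + s%:A / (t - q%:A)) = - s%:A / (t - q%:A) ^+ 2.
Proof.
rewrite ratfun_derivD ratfun_derivMalg ratfun_deriv_alg ratfun_derivV.
have -> : ratfun_deriv (t - q%:A) = 1.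
  by rewrite t_sub_alg ratfun_deriv_poly derivXsubC tofrac1.
by rewrite mulr1 add0r -exprVn expr2 mulrN !mulNr.
Qed.

Lemma alg_eq0 (c : K) : (c%:A == 0 :> ratfun K) = (c == 0).
Proof. by rewrite alg_tofrac tofrac_eq0 polyC_eq0. Qed.

Section Poles.
Variables (a a' : seq K) (mu : Ra a -> Ra a') (phi : ratfun K).
Hypothesis mu_map : bracket_map mu.
Hypothesis muM : forall g, val (mu (Ra_t a * g)) = phi * val (mu g).

Lemma mu_inv_sub z : z \in a ->
  exists g : Ra a', (phi - z%:A) * val g = val (mu 1).
Proof.
move=> za; exists (mu (Ra_t a - z%:A)^-1).
have := bracket_map_horner mu_map muM ('X - z%:P) (Ra_t a - z%:A)^-1.
rewrite !rmorphB /= !horner_algX !horner_algC => <-.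
by rewrite divrr ?Ra_unitB.
Qed.

Lemma affine_pole x y z : x != 0 -> phi = x%:A * t + y%:A -> z \in a ->
  x^-1 * z - y / x \in a'.
Proof.
move=> x0 defphi /mu_inv_sub[g].
have := bracket_map_one mu_map muM.
rewrite defphi ratfun_deriv_affine => e1 eg.
have {e1 eg} : val g * (x%:P * (x%:P * 'X + (y - z)%:P))%:F = 1%:F.
  rewrite tofrac1 -e1 -eg !alg_tofrac !tofracM tofracD tofracM polyCB tofracB.
  by rewrite /ratfun_t; ring.
move=> /Ra_pole; apply; last by rewrite hornerE oner_eq0.
by rewrite rootE !(hornerM, hornerD, hornerC, hornerX); apply/eqP; field.
Qed.

Lemma inversion_pole0 q r s : s != 0 -> phi = r%:A + s%:A / (t - q%:A) ->
  q \in a'.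
Proof.
move=> s0 defphi; have := bracket_map_one mu_map muM.
have [f] : exists f : Ra a', val f = phi ^+ 3 * val (mu 1).
  exists (mu (horner_alg (Ra_t a) 'X^3 * 1)).
  by rewrite (bracket_map_horner mu_map muM) rmorphXn /= horner_algX.
rewrite {}defphi ratfun_deriv_inversion t_sub_alg.
have : ('X - q%:P)%:F != 0 :> ratfun K by rewrite -t_sub_alg t_sub_alg_neq0.
have : s%:A != 0 :> ratfun K by rewrite alg_eq0.
set T := ('X - q%:P)%:F => sA0 T0 ef e1.
have {ef e1} : val f * (s%:P * ('X - q%:P))%:F
    = (- (r%:P * ('X - q%:P) + s%:P) ^+ 3)%:F.
  rewrite tofracN tofracXn tofracD !tofracM -!alg_tofrac -/T.
  by rewrite ef; apply: (inversion_cube _ sA0 T0 e1).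
move=> /Ra_pole; apply; first by rewrite rootE !hornerE subrr mulr0.
by rewrite !hornerE subrr mulr0 add0r oppr_eq0 expf_neq0.
Qed.

Lemma inversion_pole q r s z : s != 0 -> phi = r%:A + s%:A / (t - q%:A) ->
  z \in a -> z != r -> q + s / (z - r) \in a'.
Proof.
move=> s0 defphi za zr; have := bracket_map_one mu_map muM.
have [g] := mu_inv_sub za.
rewrite {}defphi ratfun_deriv_inversion t_sub_alg.
have : ('X - q%:P)%:F != 0 :> ratfun K by rewrite -t_sub_alg t_sub_alg_neq0.
have : s%:A != 0 :> ratfun K by rewrite alg_eq0.
set T := ('X - q%:P)%:F => sA0 T0 eg e1.
have {eg e1} : val g * (s%:P * ((r - z)%:P * ('X - q%:P) + s%:P))%:F
    = (- ('X - q%:P) ^+ 3)%:F.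
  rewrite tofracN tofracXn tofracM tofracD tofracM -!alg_tofrac -/T scalerBl.
  exact: (inversion_quotient T0 eg e1).
have zr0 : z - r != 0 by rewrite subr_eq0.
move=> /Ra_pole; apply.
  rewrite rootE !(hornerM, hornerD, hornerN, hornerC, hornerX).
  by apply/eqP; field.
rewrite !hornerE oppr_eq0 expf_neq0 // addrC addKr.
by rewrite mulf_neq0 ?invr_eq0.
Qed.

End Poles.

End PolesOfMultipliers.

Lemma affine_inverse (F : fieldType) (X Y T p q : F) : X != 0 ->
  q * (T - Y) = X * p -> p = (X^-1 * T + - Y * X^-1) * q.
Proof. by move=> X0 e; apply: (mulfI X0); rewrite -e; field. Qed.

Lemma inversion_relation (F : fieldType) (R S T C p q : F) : T - C != 0 ->
  q * T = p -> q * (C * (R + S / (T - C) - R) + S) = p * (R + S / (T - C) - R).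
Proof. by move=> TC <-; field; rewrite TC. Qed.

Lemma inversion_inverse (F : fieldType) (R S T C p q : F) : T - R != 0 ->
  q * (C * (T - R) + S) = p * (T - R) -> p = (C + S / (T - R)) * q.
Proof.
by move=> TR e; apply: (mulIf TR); rewrite -e; field; rewrite TR.
Qed.

Section Rigidity.
Variable K : fieldType.
Implicit Types (a : seq K) (phi : ratfun K).
Hypothesis K0 : [pchar K] =i pred0.
Local Notation t := (ratfun_t : ratfun K).

Lemma algM (c d : K) : (c * d)%:A = c%:A * d%:A :> ratfun K.
Proof. exact: (rmorphM (in_alg (ratfun K))). Qed.

Lemma algV (c : K) : (c^-1)%:A = (c%:A)^-1 :> ratfun K.
Proof. exact: (fmorphV (in_alg (ratfun K))). Qed.

Section InversePair.
Variables (a a' : seq K) (mu : Ra a -> Ra a') (nu : Ra a' -> Ra a).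
Hypothesis mu_map : bracket_map mu.
Hypothesis nu_map : bracket_map nu.
Hypothesis nuK : cancel nu mu.

Lemma multiplier_pair : exists phi psi,
  [/\ forall g, val (mu (Ra_t a * g)) = phi * val (mu g),
      forall g, val (nu (Ra_t a' * g)) = psi * val (nu g) &
      (exists x y : K, [/\ x != 0, phi = x%:A * t + y%:A &
                          psi = (x^-1)%:A * t + (- y / x)%:A]) \/
      (exists q r s : K, [/\ s != 0, phi = r%:A + s%:A / (t - q%:A) &
                            psi = q%:A + s%:A / (t - r%:A)])].
Proof.
have [phi muM] := bracket_map_semilinear mu_map K0.
have [psi nuM] := bracket_map_semilinear nu_map K0.
exists phi, psi; split=> //.
have tr := bracket_map_transcendental mu_map muM.
have [P [Q [Q0 _ defpsi]]] := ratfun_coprime psi.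
have QF0 : Q%:F != 0 :> ratfun K by rewrite tofrac_eq0.
have eQP : horner_alg phi Q * t = horner_alg phi P.
  have e : horner_alg (Ra_t a) Q * nu (Ra_t a') = horner_alg (Ra_t a) P * nu 1.
    apply: val_inj; rewrite !rmorphM /= !val_horner_t.
    by rewrite -[Ra_t a']mulr1 nuM mulrA defpsi mulrCA divff ?mulr1.
  have := bracket_map_horner mu_map muM Q (nu (Ra_t a')).
  by rewrite e (bracket_map_horner mu_map muM) !nuK mulr1.
have tr_inj A B : horner_alg phi A = horner_alg phi B -> A = B.
  move=> e; apply/eqP; rewrite -subr_eq0; apply/eqP/tr.
  by rewrite rmorphB /= e subrr.
have psiP f : P%:F = f * Q%:F -> psi = f.
  by move=> e; rewrite defpsi e mulfK.
have := linear_fractional tr Q0; rewrite mulrC => /(_ _ eQP).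
case=> [[x [y [x0 defphi]]]|[q [r [s [s0 defphi]]]]]; [left|right].
  exists x, y; split=> //; apply: psiP.
  have /(congr1 (@FracField.tofrac _)) : Q * ('X - y%:P) = x%:P * P.
    apply: tr_inj; rewrite !rmorphM /= rmorphB /= horner_algX !horner_algC.
    by rewrite {2}defphi addrK mulrCA eQP.
  rewrite !tofracM -t_sub_alg -alg_tofrac algM scaleNr algV.
  have xA0 : x%:A != 0 :> ratfun K by rewrite alg_eq0.
  exact: (affine_inverse xA0).
exists q, r, s; split=> //; apply: psiP.
have /(congr1 (@FracField.tofrac _)) :
    Q * (q%:P * ('X - r%:P) + s%:P) = P * ('X - r%:P).
  apply: tr_inj; rewrite !(rmorphM, rmorphD, rmorphN) /= horner_algX !horner_algC.
  rewrite [in X in _ * X = _]defphi [in X in _ = _ * X]defphi.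
  by apply: inversion_relation; rewrite ?t_sub_alg_neq0.
rewrite !tofracM tofracD tofracM -t_sub_alg -!alg_tofrac.
exact/inversion_inverse/t_sub_alg_neq0.
Qed.

End InversePair.

Theorem bracket_map_rigidity (a a' : seq K) (mu : Ra a -> Ra a') :
  uniq a -> uniq a' -> bracket_map mu ->
  reorderings (frakC1 a `|` frakC2 a)%classic a'.
Proof.
move=> ua ua' mu_map; have [_ [nu muK nuK] _] := mu_map.
have nu_map := bracket_map_inv mu_map muK nuK.
have [phi [psi [muM nuM]]] := multiplier_pair mu_map nu_map nuK.
case=> [[x [y [x0 defphi defpsi]]]|[q [r [s [s0 defphi defpsi]]]]].
  exists [seq x^-1 * z + - y / x | z <- a].
    by left; exists x^-1, (- y / x); rewrite invr_eq0.
  have fwd z : z \in a -> x^-1 * z + - y / x \in a'.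
    by move=> za; have := affine_pole mu_map muM x0 defphi za; rewrite mulNr.
  apply: uniq_perm => //.
    by rewrite map_inj_uniq // => z w /addIr /mulfI; apply; rewrite invr_eq0.
  move=> w; apply/idP/mapP => [wa'|[z /fwd za ->] //].
  have xV0 : x^-1 != 0 by rewrite invr_eq0.
  exists (x * w + y); last by field.
  have <- : x^-1^-1 * w - - y / x / x^-1 = x * w + y.
    by field; rewrite x0 oner_neq0.
  exact: (affine_pole nu_map nuM xV0 defpsi wa').
have qa' := inversion_pole0 mu_map muM s0 defphi.
have ra := inversion_pole0 nu_map nuM s0 defpsi.
have fwd z : z \in a -> s * (z - r)^-1 + q \in a'.
  move=> za; have [->|zr] := eqVneq z r.
    by rewrite subrr invr0 mulr0 add0r.
  by rewrite addrC; exact: (inversion_pole mu_map muM s0 defphi za zr).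
exists [seq s * (z - r)^-1 + q | z <- a].
  right; exists s, q, (index r a); split=> //; first by rewrite index_mem.
  by rewrite nth_index.
apply: uniq_perm => //.
  by rewrite map_inj_uniq // => z w /addIr /(mulfI s0) /invr_inj /addIr.
move=> w; apply/idP/mapP => [wa'|[z /fwd za ->] //].
have [->|wq] := eqVneq w q.
  by exists r => //; rewrite subrr invr0 mulr0 add0r.
exists (r + s / (w - q)).
  exact: (inversion_pole nu_map nuM s0 defpsi wa' wq).
by rewrite [r + _]addrC addrK invfM invrK mulVKf // subrK.
Qed.

End Rigidity.

Lemma quotient_rule (F : fieldType) (p q p' q' d : F) : q != 0 ->
  p' * d * q^-1 + p * - (q^-1 * q^-1 * (q' * d))
    = (p' * q - p * q') / q ^+ 2 * d.
Proof. by move=> q0; field. Qed.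

Lemma pushforward_bracket (F : fieldType) (f g f' g' h h' d : F) : h * d = 1 ->
  h * (f * g' - g * f')
    = h * f * (h' * g + h * (g' * d)) - h * g * (h' * f + h * (f' * d)).
Proof.
move=> hd; transitivity (h * (h * d) * (f * g' - g * f')); last by ring.
by rewrite hd mulr1.
Qed.

Lemma inversion_subE (F : fieldType) (R S Z X Q : F) : R - Z != 0 -> X - Q != 0 ->
  (R + S / (X - Q) - Z)^-1
    = (R - Z)^-1 * ((X - Q) * (X - Q - S / - (R - Z))^-1).
Proof.
rewrite [R + _ - Z]addrAC; move: (X - Q) (R - Z) => A B B0 A0.
have -> : A - S / - B = A * (B + S / A) / B.
  rewrite invrN mulrN opprK mulrDr [A * (S / A)]mulrC divfK //.
  by rewrite mulrDl mulfK.
by rewrite !invfM invrK -!mulrA mulVKf // [RHS]mulrC mulfK.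
Qed.

Lemma inversion_unit (F : fieldType) (S T : F) : S != 0 -> T != 0 ->
  - S^-1 * T ^+ 2 * (- S / T ^+ 2) = 1.
Proof.
move=> S0 T0; rewrite !mulNr mulrN opprK mulrACA mulVf //.
by rewrite divff ?mulr1 ?expf_neq0.
Qed.

Section Substitution.
Variable K : fieldType.
Implicit Types (a : seq K) (f g phi psi h : ratfun K) (p P Q : {poly K}).
Local Notation t := (ratfun_t : ratfun K).

Lemma ratfun_deriv_horner phi p :
  ratfun_deriv (horner_alg phi p) = horner_alg phi p^`() * ratfun_deriv phi.
Proof.
elim/poly_ind: p => [|p c IHp].
  by rewrite deriv0 !rmorph0 mul0r -tofrac0 ratfun_deriv_poly deriv0.
rewrite derivMXaddC !rmorphD !rmorphM /= !horner_algX horner_algC.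
rewrite ratfun_derivD ratfun_derivM ratfun_deriv_alg IHp addr0 mulrDl addrC.
by rewrite mulrAC.
Qed.

Lemma deriv_neq0_transcendental phi : [pchar K] =i pred0 ->
  ratfun_deriv phi != 0 -> transcendental phi.
Proof.
move=> K0 dphi p; have [n] := ubnP (size p); elim: n p => // n IHn p lepn p0.
have dp0 : p^`() = 0.
  have [->|pn0] := eqVneq p 0; first by rewrite deriv0.
  apply: IHn; first exact: leq_trans (lt_size_deriv pn0) lepn.
  apply: (mulIf dphi); rewrite mul0r -ratfun_deriv_horner p0.
  by rewrite -tofrac0 ratfun_deriv_poly deriv0.
have pC : p = (p`_0)%:P.
  apply/polyP => -[|i]; rewrite coefC //=; apply/eqP.
  move/polyP/(_ i)/eqP: dp0; rewrite coef_deriv coef0 -mulr_natr mulf_eq0.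
  by rewrite (proj1 (pcharf0P K) K0) orbF.
move/eqP: p0; rewrite pC horner_algC alg_eq0 => /eqP ->.
by rewrite polyC0.
Qed.

Definition ratfun_subst phi f : ratfun K :=
  horner_alg phi (\n_(repr f)) / horner_alg phi (\d_(repr f)).

Section Transcendental.
Variable phi : ratfun K.
Hypothesis tr : transcendental phi.
Local Notation tau := (ratfun_subst phi).

Let ev0 p : (horner_alg phi p == 0) = (p == 0).
Proof. by apply/eqP/eqP => [/tr //|->]; rewrite rmorph0. Qed.

Lemma ratfun_substE P Q : Q != 0 ->
  tau (P%:F / Q%:F) = horner_alg phi P / horner_alg phi Q.
Proof.
move=> Q0; rewrite /ratfun_subst; set f := P%:F / Q%:F.
have d0 : \d_(repr f) != 0 by exact: denom_ratioP.
have := ratfun_repr f; move: (\n_(repr f)) (\d_(repr f)) d0 => n d d0.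
rewrite /f => /eqP; rewrite eqr_div ?tofrac_eq0 // -!tofracM tofrac_eq => /eqP e.
by apply/eqP; rewrite eqr_div ?ev0 // -!rmorphM /= e.
Qed.

Lemma ratfun_subst_poly P : tau P%:F = horner_alg phi P.
Proof.
by rewrite -[P%:F]divr1 -tofrac1 ratfun_substE ?oner_eq0 // rmorph1 divr1.
Qed.

Lemma ratfun_substM : {morph tau : f g / f * g}.
Proof.
move=> f g; rewrite (ratfun_repr f) (ratfun_repr g).
move: (\n_(repr f)) (\d_(repr f)) (denom_ratioP (repr f)) => p q q0.
move: (\n_(repr g)) (\d_(repr g)) (denom_ratioP (repr g)) => r s s0.
rewrite mulf_div -!tofracM !ratfun_substE ?mulf_neq0 //.
by rewrite !rmorphM /= mulf_div.
Qed.

Lemma ratfun_substD : {morph tau : f g / f + g}.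
Proof.
move=> f g; rewrite (ratfun_repr f) (ratfun_repr g).
move: (\n_(repr f)) (\d_(repr f)) (denom_ratioP (repr f)) => p q q0.
move: (\n_(repr g)) (\d_(repr g)) (denom_ratioP (repr g)) => r s s0.
rewrite addf_div ?tofrac_eq0 // -!tofracM -tofracD !ratfun_substE ?mulf_neq0 //.
by rewrite addf_div ?ev0 // !(rmorphM, rmorphD).
Qed.

Lemma ratfun_subst_alg (c : K) : tau c%:A = c%:A.
Proof. by rewrite {1}alg_tofrac ratfun_subst_poly horner_algC. Qed.

Lemma ratfun_subst1 : tau 1 = 1.
Proof. by have := ratfun_subst_alg 1; rewrite scale1r. Qed.

Lemma ratfun_substX : tau t = phi.
Proof. by rewrite ratfun_subst_poly horner_algX. Qed.

Lemma ratfun_substZ (c : K) f : tau (c *: f) = c *: tau f.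
Proof.
by rewrite -[f in LHS]mul1r scalerAl ratfun_substM ratfun_subst_alg mulr_algl.
Qed.

Lemma ratfun_substV f : tau f^-1 = (tau f)^-1.
Proof.
have [->|f0] := eqVneq f 0.
  by rewrite invr0 -tofrac0 ratfun_subst_poly rmorph0 invr0.
have := ratfun_substM f f^-1; rewrite divff // ratfun_subst1 => e.
have tf0 : tau f != 0.
  by apply/eqP => tf0; move/eqP: e; rewrite tf0 mul0r oner_eq0.
by apply: (mulfI tf0); rewrite -e divff.
Qed.

Lemma ratfun_subst_deriv f :
  ratfun_deriv (tau f) = tau (ratfun_deriv f) * ratfun_deriv phi.
Proof.
rewrite {1}(ratfun_repr f) [in RHS](ratfun_repr f).
move: (\n_(repr f)) (\d_(repr f)) (denom_ratioP (repr f)) => p q q0.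
rewrite ratfun_derivE // !ratfun_substE ?expf_neq0 //.
rewrite ratfun_derivM ratfun_derivV !ratfun_deriv_horner.
rewrite !(rmorphB, rmorphM, rmorphXn) /=.
by apply: quotient_rule; rewrite ev0.
Qed.

End Transcendental.

(* The data of an isomorphism [f d/dt |-> h * f(phi) d/dt] from [V_a] to
   [V_a']; pushing a vector field forward along [phi] forces [h = 1 / phi']. *)
Definition admissible a a' phi h :=
  [/\ h * ratfun_deriv phi = 1, h \in subalg_gen (Ra_gens a'),
      phi \in subalg_gen (Ra_gens a') &
      {in a, forall z, (phi - z%:A)^-1 \in subalg_gen (Ra_gens a')}].

Hypothesis K0 : [pchar K] =i pred0.

Lemma admissible_transcendental a a' phi h :
  admissible a a' phi h -> transcendental phi.
Proof.
move=> [hphi _ _ _]; apply: deriv_neq0_transcendental => //.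
by apply: contra_eqN hphi => /eqP ->; rewrite mulr0 eq_sym oner_neq0.
Qed.

Lemma ratfun_subst_Ra a a' phi h (f : Ra a) : admissible a a' phi h ->
  ratfun_subst phi (val f) \in subalg_gen (Ra_gens a').
Proof.
move=> adm; have tr := admissible_transcendental adm.
have [_ _ phia' phiV] := adm.
pose S : {pred ratfun K} :=
  [pred g | ratfun_subst phi g \in subalg_gen (Ra_gens a')].
have SE g : (g \in S) = (ratfun_subst phi g \in subalg_gen (Ra_gens a')) by [].
rewrite -SE.
have /asboolP := valP f; apply.
- split; first by rewrite SE ratfun_subst1 // rpred1.
    move=> c g g'; rewrite !SE => gS g'S.
    by rewrite ratfun_substD // ratfun_substZ // rpredD ?rpredZ.
  by move=> g g'; rewrite !SE ratfun_substM // => gS g'S; rewrite rpredM.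
- move=> g; rewrite inE => /orP[/eqP ->|/mapP[z za ->]]; rewrite SE.
    by rewrite ratfun_substX.
  rewrite ratfun_substV // -scaleNr ratfun_substD // ratfun_substX //.
  by rewrite ratfun_subst_alg // scaleNr phiV.
Qed.

Lemma ratfun_subst_comp phi psi : transcendental phi -> transcendental psi ->
  ratfun_subst psi phi = t -> forall f, ratfun_subst psi (ratfun_subst phi f) = f.
Proof.
move=> trphi trpsi psiphi f.
have E p : ratfun_subst psi (horner_alg phi p) = p%:F.
  elim/poly_ind: p => [|p c IHp].
    by rewrite rmorph0 -tofrac0 ratfun_subst_poly // rmorph0.
  rewrite rmorphD rmorphM /= horner_algX horner_algC.
  rewrite ratfun_substD // ratfun_substM // IHp psiphi ratfun_subst_alg //.
  by rewrite tofracD tofracM alg_tofrac.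
rewrite [ratfun_subst phi f]/ratfun_subst ratfun_substM // ratfun_substV // !E.
by rewrite -ratfun_repr.
Qed.

Lemma bracket_map_exists a a' phi psi h k :
  admissible a a' phi h -> admissible a' a psi k ->
  ratfun_subst psi phi = t -> ratfun_subst phi psi = t ->
  exists2 mu : Ra a -> Ra a', bracket_map mu &
    forall f : Ra a, val (mu f) = h * ratfun_subst phi (val f).
Proof.
move=> adm adm' psiphi phipsi.
have tr := admissible_transcendental adm.
have tr' := admissible_transcendental adm'.
have [hphi hR _ _] := adm; have [kpsi kR _ _] := adm'.
have muR (f : Ra a) : h * ratfun_subst phi (val f) \in subalg_gen (Ra_gens a').
  apply: rpredM; [exact: hR|exact: (ratfun_subst_Ra f adm)].
have nuR (f : Ra a') : k * ratfun_subst psi (val f) \in subalg_gen (Ra_gens a).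
  apply: rpredM; [exact: kR|exact: (ratfun_subst_Ra f adm')].
have pullback chi xi (l m : ratfun K) : transcendental chi -> transcendental xi ->
    ratfun_subst xi chi = t -> l * ratfun_deriv chi = 1 ->
    m * ratfun_deriv xi = 1 -> m * ratfun_subst xi l = 1.
  move=> trc trx xichi lchi mxi.
  have := congr1 (ratfun_subst xi) lchi.
  rewrite ratfun_substM // ratfun_subst1 //.
  have := ratfun_subst_deriv trx chi; rewrite xichi ratfun_deriv_t => e e'.
  rewrite -[LHS]mulr1 [X in _ * X = _]e [_ * ratfun_deriv xi]mulrC.
  by rewrite mulrACA mxi e' mulr1.
have hk := pullback phi psi h k tr tr' psiphi hphi kpsi.
have kh := pullback psi phi k h tr' tr phipsi kpsi hphi.
pose mu (f : Ra a) := MkRa (muR f); pose nu (f : Ra a') := MkRa (nuR f).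
exists mu => //; split.
- move=> c f g; apply: val_inj.
  change (h * ratfun_subst phi (c *: val f + val g)
    = c *: (h * ratfun_subst phi (val f)) + h * ratfun_subst phi (val g)).
  rewrite ratfun_substD // ratfun_substZ // mulrDr. congr (_ + _); exact: mulrCA.
- exists nu => f; apply: val_inj => /=;
    rewrite ratfun_substM // ratfun_subst_comp //.
    by rewrite mulrA hk mul1r.
  by rewrite mulrA kh mul1r.
- move=> f g; apply: val_inj.
  change (h * ratfun_subst phi
        (val f * ratfun_deriv (val g) - val g * ratfun_deriv (val f))
    = h * ratfun_subst phi (val f) * ratfun_deriv (h * ratfun_subst phi (val g))
      - h * ratfun_subst phi (val g) * ratfun_deriv (h * ratfun_subst phi (val f))).
  rewrite !(ratfun_derivM h) !ratfun_subst_deriv //.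
  rewrite -mulN1r -[-1]scaleN1r -scalerAl.
  rewrite mul1r ratfun_substD // ratfun_substZ // !ratfun_substM // scaleN1r.
  exact: pushforward_bracket.
Qed.

Lemma affine_admissible a a' x y : x != 0 ->
  {in a, forall z, x^-1 * (z - y) \in a'} ->
  admissible a a' (x%:A * t + y%:A) (x^-1)%:A.
Proof.
move=> x0 aa'; have xA0 : x%:A != 0 :> ratfun K by rewrite alg_eq0.
have alg_mem (c : K) : c%:A \in subalg_gen (Ra_gens a') by rewrite rpredZ ?rpred1.
have tR : t \in subalg_gen (Ra_gens a') by exact: valP (Ra_t a').
split.
- by rewrite ratfun_deriv_affine algV mulVf.
- exact: alg_mem.
- apply: rpredD; [apply: rpredM; [exact: alg_mem|exact: tR]|exact: alg_mem].
- move=> z /aa' /Ra_gensV /mem_subalg_gen zR.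
  have -> : x%:A * t + y%:A - z%:A = x%:A * (t - (x^-1 * (z - y))%:A).
    rewrite algM algV scalerBl [RHS]mulrBr mulVKf //.
    by rewrite -addrA opprB.
  by rewrite invfM -algV; apply: rpredM; [exact: alg_mem|exact: zR].
Qed.

Lemma inversion_admissible a a' q r s : s != 0 -> q \in a' ->
  {in a, forall z, z != r -> q + s / (z - r) \in a'} ->
  admissible a a' (r%:A + s%:A / (t - q%:A)) (- (s^-1)%:A * (t - q%:A) ^+ 2).
Proof.
move=> s0 qa' aa'; have sA0 : s%:A != 0 :> ratfun K by rewrite alg_eq0.
have T0 := t_sub_alg_neq0 q.
have alg_mem (c : K) : c%:A \in subalg_gen (Ra_gens a') by rewrite rpredZ ?rpred1.
have tR : t \in subalg_gen (Ra_gens a') by exact: valP (Ra_t a').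
have qR := mem_subalg_gen (Ra_gensV qa').
have TR : t - q%:A \in subalg_gen (Ra_gens a').
  by apply: rpredB; [exact: tR|exact: alg_mem].
split.
- rewrite ratfun_deriv_inversion algV.
  exact: (inversion_unit sA0 T0).
- apply: rpredM; first by rewrite rpredN; exact: alg_mem.
  by apply: rpredX; exact: TR.
- apply: rpredD; [exact: alg_mem|apply: rpredM; [exact: alg_mem|exact: qR]].
- move=> z za.
  have [->|zr] := eqVneq z r.
    rewrite addrC addKr invfM invrK -algV.
    by apply: rpredM; [exact: alg_mem|exact: TR].
  have /Ra_gensV /mem_subalg_gen zR := aa' z za zr.
  have rz0 : (r - z)%:A != 0 :> ratfun K by rewrite alg_eq0 subr_eq0 eq_sym.
  have -> : (r%:A + s%:A / (t - q%:A) - z%:A)^-1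
    = (r - z)%:A^-1 * ((t - q%:A) * (t - (q + s / (z - r))%:A)^-1).
    have -> : (q + s / (z - r))%:A = q%:A + s%:A / - (r - z)%:A :> ratfun K.
      by rewrite -[z - r]opprB [LHS]scalerDl algM algV scaleNr.
    move: rz0; rewrite [(r - z)%:A]scalerBl [- (q%:A + _)]opprD addrA => rz0.
    exact: (inversion_subE _ rz0 T0).
  rewrite -algV; apply: rpredM; first exact: alg_mem.
  by apply: rpredM; [exact: TR|exact: zR].
Qed.

End Substitution.

Lemma second_kind_power (F : fieldType) (X T : F) (k : int) : X != 0 -> T != 0 ->
  - X^-1 * T ^+ 2 * (X / T) ^ k = - X ^ (k - 1) * T ^ (2 - k).
Proof.
move=> X0 T0; rewrite expfzMl exprz_inv !expfzDr // !mulNr; congr (- _).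
by rewrite mulrACA [X^-1 * _]mulrC.
Qed.

Lemma second_kind_factor (F : fieldType) (X T D U : F) (k : int) : T != 0 ->
  - X^-1 * T ^+ 2 * (D * (U / T)) ^ k = - X^-1 * D ^ k * (U ^ k * T ^ (2 - k)).
Proof.
move=> T0; rewrite !expfzMl exprz_inv expfzDr //.
by rewrite mulrACA [T ^+ 2 * _]mulrCA.
Qed.

Lemma second_kind_shift (F : fieldType) (X T Y Z B : F) :
  T - Y != 0 -> Z - B != 0 ->
  Z + X / (T - Y) - B = (Z - B) * ((T - (Y - X / (Z - B))) / (T - Y)).
Proof.
rewrite [in RHS]opprB [T + (_ - _)]addrCA [Z + _ - B]addrAC.
move: (T - Y) (Z - B) => A D A0 D0; rewrite mulrDl divff // mulrDr mulr1.
by rewrite addrC mulrA mulrCA divff // mulr1.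
Qed.

Section KindsExist.
Variable K : fieldType.
Hypothesis K0 : [pchar K] =i pred0.
Implicit Types (a : seq K) (f phi : ratfun K).
Local Notation t := (ratfun_t : ratfun K).

Lemma ratfun_substXz phi f (k : int) : transcendental phi ->
  ratfun_subst phi (f ^ k) = ratfun_subst phi f ^ k.
Proof.
move=> tr; have X n : ratfun_subst phi (f ^+ n) = ratfun_subst phi f ^+ n.
  elim: n => [|n IHn]; first by rewrite !expr0 ratfun_subst1.
  by rewrite !exprS ratfun_substM // IHn.
by case: k => n; rewrite /exprz ?ratfun_substV // X.
Qed.

Lemma algXz (c : K) (k : int) : (c ^ k)%:A = c%:A ^ k :> ratfun K.
Proof. exact: (fmorphXz (in_alg (ratfun K))). Qed.

Lemma val_Ra_tXz a z (k : int) : z \in a ->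
  val ((Ra_t a - z%:A) ^ k) = (t - z%:A) ^ k.
Proof. by move=> za; rewrite rmorphXz ?Ra_unitB. Qed.

Lemma bracket_map_vfield a a' (mu : Ra a -> Ra a') phi h c z (k : int)
    (g : Ra a') : transcendental phi ->
  (forall f : Ra a, val (mu f) = h * ratfun_subst phi (val f)) ->
  z \in a -> h * (phi - z%:A) ^ k = c%:A * val g ->
  vfield (mu (vfield ((Ra_t a - z%:A) ^ k) (Ra_t a))) = c *: vfield g.
Proof.
move=> tr muE za e; rewrite vfield_t.
have -> : c *: vfield g = vfield (c *: g).
  by apply: DerP => f; rewrite scale_derE [LHS]scalerAl.
congr (vfield _); apply: val_inj.
rewrite muE [X in ratfun_subst _ X](val_Ra_tXz _ za) ratfun_substXz //.
rewrite -scaleNr ratfun_substD // ratfun_subst_alg // ratfun_substX // scaleNr e.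
by rewrite mulr_algl.
Qed.

Lemma ratfun_subst_affine phi (x y : K) : transcendental phi ->
  ratfun_subst phi (x%:A * t + y%:A) = x%:A * phi + y%:A.
Proof.
move=> tr; rewrite ratfun_substD // ratfun_substM // ratfun_substX //.
by rewrite !ratfun_subst_alg.
Qed.

Lemma ratfun_subst_inversion phi (q r s : K) : transcendental phi ->
  ratfun_subst phi (r%:A + s%:A / (t - q%:A)) = r%:A + s%:A / (phi - q%:A).
Proof.
move=> tr; rewrite ratfun_substD // ratfun_subst_alg // ratfun_substM //.
rewrite ratfun_substV // ratfun_subst_alg // -scaleNr ratfun_substD //.
by rewrite ratfun_substX // ratfun_subst_alg // scaleNr.
Qed.

Lemma first_kind_exists a a' (x y : K) : x != 0 ->
  perm_eq a' [seq x * z + y | z <- a] ->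
  exists psi : Va a -> Va a', first_kind psi.
Proof.
move=> x0 a'E; have xV0 : x^-1 != 0 by rewrite invr_eq0.
have memb z : z \in a -> x * z + y \in a'.
  by move=> za; rewrite (perm_mem a'E); apply: map_f.
pose phi : ratfun K := (x^-1)%:A * t + (- y / x)%:A.
pose psi : ratfun K := x%:A * t + y%:A.
have adm : admissible a a' phi (x^-1^-1)%:A.
  apply: affine_admissible => // z za; rewrite invrK.
  by rewrite mulrBr mulrCA divff // mulr1 opprK memb.
have adm' : admissible a' a psi (x^-1)%:A.
  apply: affine_admissible => // w; rewrite (perm_mem a'E) => /mapP[z za ->].
  by rewrite addrK mulKf.
have tr := admissible_transcendental K0 adm.
have tr' := admissible_transcendental K0 adm'.
have xA0 : x%:A != 0 :> ratfun K by rewrite alg_eq0.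
have [||mu mu_map muE] := bracket_map_exists K0 adm adm'.
- rewrite ratfun_subst_affine // /psi mulrDr algV mulKf // -addrA.
  by rewrite mulNr scaleNr algM algV [_ * x%:A^-1]mulrC subrr addr0.
- rewrite ratfun_subst_affine // /phi mulrDr algV mulVKf // -addrA.
  by rewrite mulNr scaleNr algM algV mulrN mulrCA divff // mulr1 addNr addr0.
exists (fun D : Va a => vfield (mu (D (Ra_t a))) : Va a'); split.
- exact: lie_iso_of_bracket_map.
- by rewrite (perm_size a'E) size_map.
exists [seq x * z + y | z <- a]; first by rewrite perm_sym.
exists x^-1 => //; split=> [i lti|k i lti].
  rewrite !(nth_map 0) //; last exact: leq_trans lti.
  by rewrite opprD addrACA subrr addr0 -mulrBr mulKf.
have za : a`_i \in a by apply: mem_nth.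
apply: (bracket_map_vfield tr muE za).
rewrite val_Ra_tXz (nth_map 0) ?memb //.
have -> : phi - (a`_i)%:A = (x^-1)%:A * (t - (x * a`_i + y)%:A).
  rewrite /phi mulrBr -algM mulrDr mulKf // -addrA; congr (_ + _).
  by rewrite -!scaleNr -scalerDl opprD addrC mulrC mulrN.
rewrite expfzMl mulrA; congr (_ * _).
by rewrite -algXz -algM expfzDr // -exprz_inv mulrC.
Qed.

Lemma second_kind_exists a a' (x y z0 : K) : x != 0 -> uniq a -> z0 \in a ->
  perm_eq a' [seq x * (z - z0)^-1 + y | z <- a] ->
  exists psi : Va a -> Va a', second_kind psi.
Proof.
move=> x0 ua za0 a'E; pose F z := x * (z - z0)^-1 + y.
have memb z : z \in a -> F z \in a'.
  by move=> za; rewrite (perm_mem a'E); apply: map_f.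
have F0 : F z0 = y by rewrite /F subrr invr0 mulr0 add0r.
have ya' : y \in a' by rewrite -F0 memb.
pose phi : ratfun K := z0%:A + x%:A / (t - y%:A).
pose psi : ratfun K := y%:A + x%:A / (t - z0%:A).
have adm : admissible a a' phi (- (x^-1)%:A * (t - y%:A) ^+ 2).
  by apply: inversion_admissible => // z za _; rewrite addrC memb.
have adm' : admissible a' a psi (- (x^-1)%:A * (t - z0%:A) ^+ 2).
  apply: inversion_admissible => // w; rewrite (perm_mem a'E) => /mapP[z za ->] _.
  by rewrite addrK invfM invrK mulVKf // addrC subrK.
have tr := admissible_transcendental K0 adm.
have tr' := admissible_transcendental K0 adm'.
have xA0 : x%:A != 0 :> ratfun K by rewrite alg_eq0.
have [||mu mu_map muE] := bracket_map_exists K0 adm adm'.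
- rewrite ratfun_subst_inversion // /psi [y%:A + _]addrC addrK invfM invrK.
  by rewrite mulVKf // addrC subrK.
- rewrite ratfun_subst_inversion // /phi [z0%:A + _]addrC addrK invfM invrK.
  by rewrite mulVKf // addrC subrK.
exists (fun D : Va a => vfield (mu (D (Ra_t a))) : Va a'); split.
- exact: lie_iso_of_bracket_map.
- by rewrite (perm_size a'E) size_map.
pose b := z0 :: rem z0 a; have bE : perm_eq b a by rewrite perm_sym perm_to_rem.
have ub : uniq b by rewrite (perm_uniq bE).
have sb : size b = size a by exact: perm_size.
exists b, (map F b); split=> //.
  by rewrite perm_sym (perm_trans a'E) // perm_map // perm_sym.
exists x => //.
have b0 : (map F b)`_0 = y by [].
have biE i : (0 < i < size a)%N ->
    [/\ b`_i \in a, b`_i - z0 != 0 & (map F b)`_i = F b`_i].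
  case/andP=> i0 lti; have ltb : (i < size b)%N by rewrite sb.
  split; first by rewrite -(perm_mem bE) mem_nth.
    rewrite subr_eq0 -[z0]/(b`_0) nth_uniq //; by case: i i0 {lti ltb}.
  by rewrite (nth_map 0).
have T0 := t_sub_alg_neq0 y.
have phiB : phi - z0%:A = x%:A / (t - y%:A) by rewrite /phi addrC addKr.
split.
- by move=> i /biE[_ d0 ->]; rewrite b0 addrK mulrCA divff ?mulr1.
- move=> k; apply: (bracket_map_vfield tr muE za0).
  rewrite b0 val_Ra_tXz // phiB scaleNr algXz algV.
  exact: (second_kind_power k xA0 T0).
- move=> k i /biE[bia d0 b'i]; apply: (bracket_map_vfield tr muE bia).
  rewrite b0 b'i [val _]rmorphM /= !val_Ra_tXz ?memb //.
  have -> : phi - (b`_i)%:A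
      = (z0 - b`_i)%:A * ((t - (F b`_i)%:A) / (t - y%:A)).
    have -> : (F b`_i)%:A = y%:A - x%:A / (z0 - b`_i)%:A :> ratfun K.
      rewrite /F [LHS]scalerDl algM algV -[b`_i - z0]opprB scaleNr.
      by rewrite invrN mulrN addrC.
    have dA0 : (z0 - b`_i)%:A != 0 :> ratfun K by rewrite alg_eq0 -opprB oppr_eq0.
    move: dA0; rewrite [(z0 - _)%:A]scalerBl => dA0.
    exact: (second_kind_shift _ T0 dA0).
  rewrite algM scaleNr algV algXz. exact: (second_kind_factor _ _ _ k T0).
Qed.

End KindsExist.

Section Reorderings.
Variable K : fieldType.
Implicit Types a b : seq K.

Lemma first_kind_frakC1 a a' (psi : Va a -> Va a') :
  first_kind psi -> reorderings (frakC1 a) a'.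
Proof.
move=> [_ szE [b ba' [c c0 [aE _]]]].
exists b; last by rewrite perm_sym.
exists c^-1, (b`_0 - c^-1 * a`_0); split; first by rewrite invr_eq0.
apply: (@eq_from_nth _ 0); first by rewrite size_map (perm_size ba').
move=> i; rewrite (perm_size ba') -szE => lti; rewrite (nth_map 0) //.
by rewrite addrCA -mulrBr aE // mulKf // addrC subrK.
Qed.

Lemma second_kind_frakC2 a a' (psi : Va a -> Va a') :
  (0 < size a)%N -> uniq a -> second_kind psi -> reorderings (frakC2 a) a'.
Proof.
move=> sa ua [_ szE [b [b' [ba ba' [c c0 [bE _ _]]]]]].
pose F z := c * (z - b`_0)^-1 + b'`_0.
have sb : size b = size a := perm_size ba.
have sb' : size b' = size a by rewrite szE (perm_size ba').
have b0a : b`_0 \in a by rewrite -(perm_mem ba) mem_nth // sb.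
have ub : uniq b by rewrite (perm_uniq ba).
exists (map F a).
  exists c, b'`_0, (index b`_0 a); split=> //; first by rewrite index_mem.
  by rewrite nth_index.
rewrite perm_sym; apply: perm_trans ba'.
suff -> : b' = map F b by rewrite perm_sym perm_map.
apply: (@eq_from_nth _ 0) => [|i].
  by rewrite size_map sb sb'.
rewrite sb' -sb => lti; rewrite (nth_map 0) // /F.
have [->|i0] := posnP i; first by rewrite subrr invr0 mulr0 add0r.
have d0 : b`_i - b`_0 != 0.
  by rewrite subr_eq0 nth_uniq // -?lt0n // sb.
have := bE i; rewrite i0 -sb lti => /(_ isT) <-.
by rewrite mulrAC divff // mul1r subrK.
Qed.

Lemma reorderings_frakC_distinct a a' : (0 < size a)%N -> uniq a ->
  reorderings (frakC1 a `|` frakC2 a) a' -> distinct_tuple a'.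
Proof.
move=> sa ua [b + a'b]; rewrite /distinct_tuple (perm_size a'b) (perm_uniq a'b).
case=> [[x [y [x0 ->]]]|[x [y [i [x0 _ ->]]]]]; rewrite size_map map_inj_uniq //.
  by move=> z w /addIr /(mulfI x0).
by move=> z w /addIr /(mulfI x0) /invr_inj /addIr.
Qed.

End Reorderings.

Theorem theorem8 (R : realType) (a : seq R[i]) :
  (0 < size a)%N -> uniq a ->
  [/\ reorderings (frakC1 a) =
        [set a' | distinct_tuple a' /\
                  exists psi : Va a -> Va a', first_kind psi],
      reorderings (frakC2 a) =
        [set a' | distinct_tuple a' /\
                  exists psi : Va a -> Va a', second_kind psi] &
      reorderings (frakC1 a `|` frakC2 a) =
        [set a' | distinct_tuple a' /\
                  exists psi : Va a -> Va a', lie_iso psi]].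
Proof.
move=> sa ua; have K0 : [pchar R[i]] =i pred0 by exact: Num.Theory.pchar_num.
have C1 a' : reorderings (frakC1 a) a' ->
    distinct_tuple a' /\ exists psi : Va a -> Va a', first_kind psi.
  move=> a'C; split.
    apply: reorderings_frakC_distinct sa ua _.
    by case: a'C => b; exists b => //; left.
  by case: a'C => _ [x [y [x0 ->]]]; exact: first_kind_exists.
have C2 a' : reorderings (frakC2 a) a' ->
    distinct_tuple a' /\ exists psi : Va a -> Va a', second_kind psi.
  move=> a'C; split.
    apply: reorderings_frakC_distinct sa ua _.
    by case: a'C => b; exists b => //; right.
  case: a'C => _ [x [y [i [x0 lti ->]]]]; apply: second_kind_exists => //.
  exact: mem_nth.
split; apply/seteqP; split=> a'.
- exact: C1.
- by move=> [_ [psi]]; exact: first_kind_frakC1.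
- exact: C2.
- by move=> [_ [psi psi2]]; exact: second_kind_frakC2 sa ua psi2.
- move=> [b [bC|bC] a'b].
    have [|da' [psi [iso _ _]]] := C1 a'; first by exists b.
    by split=> //; exists psi.
  have [|da' [psi [iso _ _]]] := C2 a'; first by exists b.
  by split=> //; exists psi.
- move=> [[_ ua'] [psi iso]]; apply: (bracket_map_rigidity K0 ua ua').
  exact: bracket_map_of_lie_iso iso.
Qed.
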